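(* Let $\mu\in\mathcal{P}$ and let $f_\mu\in Y'$. Then there exists a unique $x_\mu\in X=L_2(I)^n$ such that $$b_\mu(x_\mu,y)=f_\mu(y)\qquad\text{for all } y\in Y.$$ If the initial value problem $E\dot x(t)-A_\mu x(t)=\tilde f_\mu(t)$, $t\in I$, $x(0)=0$, with $\tilde f_\mu\in C(I)^n$, admits a classical solution $\tilde x_\mu\in C^1(\bar I)^n$, and $f_\mu$ is the functional $f_\mu(y)=(\tilde f_\mu,y)_{L_2}$, $y\in Y$, then $\tilde x_\mu$ coincides with $x_\mu$. Moreover, $$\gamma_\mu=\beta_\mu=\beta_\mu^*=1,$$ where $$\gamma_\mu:=\sup_{0\neq x\in X}\ \sup_{0\neq y\in Y}\frac{b_\mu(x,y)}{\|x\|_{L_2}\,|||y|||_\mu},\qquad \beta_\mu:=\inf_{0\neq x\in X}\ \sup_{0\neq y\in Y}\frac{b_\mu(x,y)}{\|x\|_{L_2}\,|||y|||_\mu},\qquad \beta_\mu^*:=\inf_{0\neq y\in Y}\ \sup_{0\neq x\in X}\frac{b_\mu(x,y)}{\|x\|_{L_2}\,|||y|||_\mu}.$$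
   Context: Let $n\in\mathbb{N}$, $T>0$, $I=(0,T)$, and let $\mathcal{P}\subset\mathbb{R}^P$ be compact. Let $E\in\mathbb{R}^{n\times n}$ (typically singular) and, for each $\mu\in\mathcal{P}$, let $A_\mu\in\mathbb{R}^{n\times n}$. It is assumed throughout that for every $\mu\in\mathcal{P}$ the matrix pencil $\{E,-A_\mu\}$ is regular, i.e. $\det(\lambda E-A_\mu)\neq 0$ for some $\lambda\in\mathbb{R}$. Write $(\cdot,\cdot)_{L_2}$ and $\|\cdot\|_{L_2}$ for the inner product and norm of $X:=L_2(I)^n=L_2(I;\mathbb{R}^n)$. Let $$Y:=H^1_E(I)^n:=\{v\in H^1(I)^n:\ v(T)\in\ker(E^T)\},\qquad B_\mu^*y:=-E^T\dot y-A_\mu^T y\quad (y\in Y),$$ with $\dot y$ the weak derivative. The space $Y$ is equipped with the (parameter-dependent) norm $|||y|||_\mu:=\|B_\mu^*y\|_{L_2}$. The dual $Y'$ (for the parameter $\mu$) consists of the linear functionals $f$ on $Y$ that are bounded with respect to $|||\cdot|||_\mu$, with norm $|||f|||_\mu':=\sup_{0\ne y\in Y} f(y)/|||y|||_\mu$. The bilinear form is $b_\mu:X\times Y\to\mathbb{R}$, $b_\mu(x,y):=(x,B_\mu^*y)_{L_2}$. *)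

(* Defs.v *)
From HB Require Import structures.
From mathcomp Require Import all_boot all_order all_algebra.
From mathcomp Require Import all_classical all_reals all_analysis.
From mathcomp Require Import measurable_realfun ess_sup_inf.

Set Implicit Arguments.
Unset Strict Implicit.
Unset Printing Implicit Defensive.

Import Order.TTheory GRing.Theory Num.Def Num.Theory.
Import numFieldNormedType.Exports.

Local Open Scope classical_set_scope.
Local Open Scope ring_scope.

(* The linear structure of Lp: operations act on representatives. *)
Section LspaceLmod.
Context d (U : measurableType d) (R : realType).
Variables (mu : {measure set U -> \bar R}) (p : \bar R) (p1 : (1 <= p)%E).

Local Notation Lp := (LspaceType mu p1).

HB.instance Definition _ := gen_eqMixin Lp.
HB.instance Definition _ := gen_choiceMixin Lp.

Lemma Lspace_eqP (u v : Lp) : u = v <-> (u : U -> R) = v %[ae mu].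
Proof.
split=> [->|uv]; first exact: ae_eq_refl.
suff : (u : {mfun_ mu, U >-> measurableTypeR R}) = v.
  case: u v {uv} => [u [[Hu]]] [v [[Hv]]] /= uv; subst v.
  by rewrite (bool_irrelevance Hu Hv).
by have /eqP := introT (@ae_eqP _ _ R U (measurableTypeR R) mu u v) uv; rewrite !reprK.
Qed.

Lemma Lspace_Lfun (u : Lp) : (u : U -> R) \in Lfun mu p.
Proof.
apply/andP; split.
  rewrite inE; exact: (@measurable_funPT _ _ _ _
    (repr (u : {mfun_ mu, U >-> measurableTypeR R}))).
rewrite inE/=; exact: Lebesgue_finite.
Qed.

Section class.
Variables (f : U -> R) (fP : f \in Lfun mu p).

Let mf : @measurable_fun _ _ U (measurableTypeR R) setT f.
Proof. by have /andP[/set_mem] := fP. Qed.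

Let fm : {mfun U >-> measurableTypeR R} :=
  HB.pack f (isMeasurableFun.Build _ _ U (measurableTypeR R) f mf).

Let cls : {mfun_ mu, U >-> measurableTypeR R} :=
  (\pi_({mfun_ mu, U >-> measurableTypeR R}) fm)%qT.

Let cls_ae : (cls : U -> R) = f %[ae mu].
Proof.
have : (repr cls == fm %[mod {mfun_ mu, U >-> measurableTypeR R}])%qT.
  by rewrite reprK.
by rewrite eqmodE => /asboolP.
Qed.

Let cls_finite : finite_norm mu p cls.
Proof.
have mcls : measurable_fun setT (cls : U -> R).
  exact: (@measurable_funPT _ _ _ _ (repr cls)).
have := fP => /andP[_]; rewrite inE/= /finite_norm; suff -> : 'N[mu]_p[EFin \o cls]%E = 'N[mu]_p[EFin \o f]%E by [].
rewrite unlock /Lnorm; case: p p1 => [r r1|_|]//=; last first.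
  case: ifPn => // _; apply: eq_ess_sup.
  by move: cls_ae; apply: filterS => x /= /(_ I) ->.
have mpow (g : U -> R) : measurable_fun setT g ->
    measurable_fun setT ((fun y : \bar R => y `^ r)%E \o (abse \o (EFin \o g))
      : U -> \bar R).
  move=> mg; apply: measurableT_comp; first exact: measurable_poweR.
  by apply: measurableT_comp => //; exact/measurable_EFinP.
congr (_ `^ _)%E.
apply: ge0_ae_eq_integral => //; [exact: mpow|exact: mpow|].
by move: cls_ae; apply: filterS => x /= + _ => /(_ I) ->.
Qed.

Definition Lclass : Lp :=
  HB.pack cls (isFinLebesgue.Build d U R mu p p1 cls cls_finite).

Lemma LclassE : (Lclass : U -> R) = f %[ae mu].
Proof. exact: cls_ae. Qed.

End class.


Lemma Lfun0 : (0 : U -> R) \in Lfun mu p.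
Proof. exact: (Lfun_submod_closed mu p1).1. Qed.

Lemma Lfun_lin (a : R) (f g : U -> R) :
  f \in Lfun mu p -> g \in Lfun mu p -> a *: f + g \in Lfun mu p.
Proof. exact: (Lfun_submod_closed mu p1).2. Qed.

Lemma LfunD (f g : U -> R) :
  f \in Lfun mu p -> g \in Lfun mu p -> f + g \in Lfun mu p.
Proof. by move=> ? ?; rewrite -[f]scale1r; exact: Lfun_lin. Qed.

Lemma LfunZ (a : R) (f : U -> R) : f \in Lfun mu p -> a *: f \in Lfun mu p.
Proof. by move=> ?; rewrite -[_ *: _]addr0; apply: Lfun_lin => //; exact: Lfun0. Qed.

Lemma LfunN (f : U -> R) : f \in Lfun mu p -> - f \in Lfun mu p.
Proof. by move=> ?; rewrite -scaleN1r; exact: LfunZ. Qed.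

Definition Lspace_zero : Lp := Lclass Lfun0.
Definition Lspace_opp (u : Lp) : Lp := Lclass (LfunN (Lspace_Lfun u)).
Definition Lspace_add (u v : Lp) : Lp :=
  Lclass (LfunD (Lspace_Lfun u) (Lspace_Lfun v)).
Definition Lspace_scale (a : R) (u : Lp) : Lp :=
  Lclass (LfunZ a (Lspace_Lfun u)).

Lemma Lspace_zeroE : \forall x \ae mu, Lspace_zero x = 0.
Proof. by apply: filterS (LclassE Lfun0) => x; exact. Qed.

Lemma Lspace_oppE u : \forall x \ae mu, Lspace_opp u x = - u x.
Proof. by apply: filterS (LclassE (LfunN (Lspace_Lfun u))) => x; exact. Qed.

Lemma Lspace_addE u v : \forall x \ae mu, Lspace_add u v x = u x + v x.
Proof.
by apply: filterS (LclassE (LfunD (Lspace_Lfun u) (Lspace_Lfun v))) => x; exact.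
Qed.

Lemma Lspace_scaleE a u : \forall x \ae mu, Lspace_scale a u x = a * u x.
Proof. by apply: filterS (LclassE (LfunZ a (Lspace_Lfun u))) => x; exact. Qed.

Local Lemma ae_ext (u v : Lp) : (\forall x \ae mu, u x = v x) -> u = v.
Proof. by move=> uv; apply/Lspace_eqP; apply: filterS uv => x ->. Qed.

Let addA : associative Lspace_add.
Proof.
move=> u v w; apply: ae_ext.
near=> x.
rewrite (near (Lspace_addE u (Lspace_add v w)) x)//.
rewrite (near (Lspace_addE (Lspace_add u v) w) x)//.
rewrite (near (Lspace_addE u v) x)// (near (Lspace_addE v w) x)//.
by rewrite addrA.
Unshelve. all: by end_near. Qed.

Let addC : commutative Lspace_add.
Proof.
move=> u v; apply: ae_ext; near=> x.
by rewrite (near (Lspace_addE u v) x)// (near (Lspace_addE v u) x)// addrC.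
Unshelve. all: by end_near. Qed.

Let add0 : left_id Lspace_zero Lspace_add.
Proof.
move=> u; apply: ae_ext; near=> x.
by rewrite (near (Lspace_addE Lspace_zero u) x)// (near Lspace_zeroE x)// add0r.
Unshelve. all: by end_near. Qed.

Let addN : left_inverse Lspace_zero Lspace_opp Lspace_add.
Proof.
move=> u; apply: ae_ext; near=> x.
rewrite (near (Lspace_addE (Lspace_opp u) u) x)// (near Lspace_zeroE x)//.
by rewrite (near (Lspace_oppE u) x)// addNr.
Unshelve. all: by end_near. Qed.

HB.instance Definition _ := GRing.isZmodule.Build Lp addA addC add0 addN.

Let scaleA a b u : Lspace_scale a (Lspace_scale b u) = Lspace_scale (a * b) u.
Proof.
apply: ae_ext; near=> x.
rewrite (near (Lspace_scaleE a (Lspace_scale b u)) x)//.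
by rewrite (near (Lspace_scaleE b u) x)// (near (Lspace_scaleE (a * b) u) x)// mulrA.
Unshelve. all: by end_near. Qed.

Let scale1 : left_id 1 Lspace_scale.
Proof.
move=> u; apply: ae_ext; near=> x.
by rewrite (near (Lspace_scaleE 1 u) x)// mul1r.
Unshelve. all: by end_near. Qed.

Let scaleDr : right_distributive Lspace_scale +%R.
Proof.
move=> a u v; apply: ae_ext; near=> x.
rewrite (near (Lspace_scaleE a (u + v)) x)//.
rewrite (near (Lspace_addE (Lspace_scale a u) (Lspace_scale a v)) x)//.
rewrite (near (Lspace_addE u v) x)// (near (Lspace_scaleE a u) x)//.
by rewrite (near (Lspace_scaleE a v) x)// mulrDr.
Unshelve. all: by end_near. Qed.

Let scaleDl u : {morph Lspace_scale^~ u : a b / a + b}.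
Proof.
move=> a b; apply: ae_ext; near=> x.
rewrite (near (Lspace_scaleE (a + b) u) x)//.
rewrite (near (Lspace_addE (Lspace_scale a u) (Lspace_scale b u)) x)//.
rewrite (near (Lspace_scaleE a u) x)//.
by rewrite (near (Lspace_scaleE b u) x)// mulrDl.
Unshelve. all: by end_near. Qed.

HB.instance Definition _ := GRing.Zmodule_isLmodule.Build R Lp
  scaleA scale1 scaleDr scaleDl.

End LspaceLmod.

Section Spaces.
Context (R : realType) (T : R) (n : nat).

(* `mrestr` restricts Lebesgue measure to I: elements of `L2` are functions on
   R modulo equality almost everywhere on I, with integrals taken over I. *)
Definition lebesgueI : {measure set (measurableTypeR R) -> \bar R} :=
  mrestr (@lebesgue_measure R) (measurable_itv `]0, T[).

Definition L2 : Type := LspaceType lebesgueI (lee1n 2).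
HB.instance Definition _ := GRing.Lmodule.on L2.

Definition L2fun (v : L2) : R -> R := v.

Definition X : Type := {ffun 'I_n -> L2}.
HB.instance Definition _ := GRing.Lmodule.on X.

Definition Xfun (x : X) : 'I_n -> R -> R := fun i => L2fun (x i).

Definition dotL2 (u v : 'I_n -> R -> R) : R :=
  \sum_i \int[lebesgue_measure]_(t in `]0, T[) (u i t * v i t).

Definition normL2 (x : X) : R := Num.sqrt (dotL2 (Xfun x) (Xfun x)).

Definition test_function (phi : R -> R) : Prop :=
  (forall (k : nat) (t : R), derivable (derive1n k phi) t 1) /\
  exists l r : R, [/\ 0 < l, r < T & forall t, t \notin `[l, r] -> phi t = 0].

Definition is_weak_derivative (v w : L2) : Prop :=
  forall phi, test_function phi ->
    \int[lebesgue_measure]_(t in `]0, T[) (L2fun v t * derive1 phi t) =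
    - \int[lebesgue_measure]_(t in `]0, T[) (L2fun w t * phi t).

Definition H1 : set L2 := [set v | exists w, is_weak_derivative v w].

(* Junk value 0 outside H1; on H1 the weak derivative is unique. *)
Definition weak_derivative (v : L2) : L2 := xget 0 (is_weak_derivative v).

(* v(T) = c, read on the representative of v that is continuous on [0, T] *)
Definition end_value (v : L2) (c : R) : Prop :=
  exists u : R -> R,
    [/\ {within `[0, T], continuous u},
        L2fun v = u %[ae lebesgue_measure in `]0, T[%classic] & u T = c].

Definition Y (E : 'M[R]_n) : set X :=
  [set y | (forall i, H1 (y i)) /\
    exists2 c : 'cV[R]_n,
      forall i, end_value (y i) (c i 0) & E^T *m c = 0].

Definition Bstar (E A : 'M[R]_n) (y : X) : X :=
  [ffun i => - (\sum_j E^T i j *: weak_derivative (y j))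
             - \sum_j A^T i j *: y j].

Definition normY (E A : 'M[R]_n) (y : X) : R := normL2 (Bstar E A y).

(* A functional on the subspace Y is a function on X of which only the values
   on Y matter. *)
Definition dualY (E A : 'M[R]_n) (f : X -> R) : Prop :=
  (forall (a : R) (u v : X), Y E u -> Y E v -> f (a *: u + v) = a * f u + f v) /\
  exists C : R, forall y, Y E y -> `|f y| <= C * normY E A y.

Definition bform (E A : 'M[R]_n) (x y : X) : R :=
  dotL2 (Xfun x) (Xfun (Bstar E A y)).

Definition bquot (E A : 'M[R]_n) (x y : X) : \bar R :=
  (bform E A x y / (normL2 x * normY E A y))%:E.

Definition nonzeroX : set X := [set x | x != 0].
Definition nonzeroY (E : 'M[R]_n) : set X := [set y | Y E y /\ y != 0].

Definition gamma (E A : 'M[R]_n) : \bar R :=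
  ereal_sup [set ereal_sup [set bquot E A x y | y in nonzeroY E]
            | x in nonzeroX].

Definition beta (E A : 'M[R]_n) : \bar R :=
  ereal_inf [set ereal_sup [set bquot E A x y | y in nonzeroY E]
            | x in nonzeroX].

Definition beta_star (E A : 'M[R]_n) : \bar R :=
  ereal_inf [set ereal_sup [set bquot E A x y | x in nonzeroX]
            | y in nonzeroY E].

(* C^1 on the closed interval: the derivative on the open interval extends
   continuously to the end points. *)
Definition C1_closed (x : R -> R) : Prop :=
  {within `[0, T], continuous x} /\
  exists2 dx : R -> R, {within `[0, T], continuous dx} &
    forall t, t \in `]0, T[ -> is_derive t 1 x (dx t).

Definition classical_solution (E A : 'M[R]_n) (f x : 'I_n -> R -> R) : Prop :=
  [/\ forall i, C1_closed (x i),
      forall t, t \in `]0, T[ ->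
        E *m (\col_j derive1 (x j) t) - A *m (\col_j x j t) = \col_j f j t
    & forall i, x i 0 = 0].

Definition regular_pencil (E A : 'M[R]_n) : Prop :=
  exists lambda : R, \det (lambda *: E - A) != 0.

End Spaces.

(* Main.v *)
Require Import Defs.
From HB Require Import structures.
From mathcomp Require Import all_boot all_order all_algebra.
From mathcomp Require Import all_classical all_reals all_analysis.
From mathcomp Require Import ring lra measurable_realfun.

Set Implicit Arguments.
Unset Strict Implicit.
Unset Printing Implicit Defensive.

Import Order.TTheory GRing.Theory Num.Def Num.Theory.
Import numFieldNormedType.Exports.

Local Open Scope classical_set_scope.
Local Open Scope ring_scope.

(**
  Writing <.,.> for the inner product of X and B for the operator
  y |-> - E^T y' - A^T y on Y, the form is b(x, y) = <x, B y> and the norm on Y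
  is |B y|.  Everything therefore follows from three facts: B is injective on
  Y, B Y is dense in X, and X is complete.
  - Existence: a functional bounded by |B y| is represented on B Y by some x,
    found by minimising |B y|^2 - 2 f(y) (riesz_range); the images of a
    minimising sequence form a Cauchy sequence, and its limit is x.
  - Uniqueness: two solutions differ by a vector orthogonal to the dense B Y.
  - Inf-sup constants: every quotient is at most 1 by Cauchy-Schwarz.  For fixed
    y the value 1 is attained at x = B y, which is nonzero by injectivity; for
    fixed x it is approached along B y -> x.

  Injectivity and density are one statement about two adjoint operators.  Let
  V u(t) be the integral of u from 0 to t, and V* u(t) its integral from t
  to T; Fubini's theorem makes them adjoint on L2.  The elements of H^1 are the
  functions c - V* w, with weak derivative w and end value c
  (weak_derivativeP, end_valueP), so Y consists of the c - V* w with E^T c = 0.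
  If B y = 0, then E^T w = - A^T y, hence E^T y = - V* (E^T w) = A^T V* y.
  If x is orthogonal to B Y, testing with y = - V* w for arbitrary w gives
  E x = A V x.  Both equations are E x = A V x for a regular pencil and
  a Volterra operator, and pencil_volterra_unique shows that the only solution
  is 0.  The argument for that is algebraic, and replaces the Weierstrass
  canonical form: with M = (l E - A)^-1 E the equation says V x = M (l V x - x);
  for k large there is N with M^k = N M^(k+1), so that z = M^k x solves the
  linear integral equation z = (l - N) V z and vanishes, and M^j x = 0 descends
  from j = k to j = 0 because V is injective.

  The description of H^1 rests on the lemma of du Bois-Reymond, which needs
  enough test functions; they are built from exp (- 1 / t).  A classical
  solution satisfies x = V x' because x(0) = 0, and the adjunction between V
  and V* turns b(x, y) into the pairing of E x' - A x with y.
*)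

(** * Matrices over a module and the uniqueness theorem for regular pencils *)

Section MatrixAction.
Context (R : fieldType) (F : lmodType R).

(** Matrices act on vectors with entries in any module, so that constant coefficients
multiply vectors of L2 functions. *)
Definition mact m n (M : 'M[R]_(m, n)) (x : {ffun 'I_n -> F}) : {ffun 'I_m -> F} :=
  [ffun i => \sum_j M i j *: x j].

Lemma mact_mul m n p (M : 'M[R]_(m, n)) (N : 'M[R]_(n, p)) x :
  mact (M *m N) x = mact M (mact N x).
Proof.
apply/ffunP => i; rewrite !ffunE.
under eq_bigr do rewrite mxE scaler_suml.
rewrite exchange_big/=; apply: eq_bigr => j _; rewrite ffunE scaler_sumr.
by apply: eq_bigr => k _; rewrite scalerA.
Qed.

Lemma mact1 n (x : {ffun 'I_n -> F}) : mact 1%:M x = x.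
Proof.
apply/ffunP => i; rewrite ffunE (bigD1 i)//= mxE eqxx scale1r big1 ?addr0//.
by move=> j ji; rewrite mxE eq_sym (negbTE ji) scale0r.
Qed.

Lemma mact_linear m n (M : 'M[R]_(m, n)) a x y :
  mact M (a *: x + y) = a *: mact M x + mact M y.
Proof.
apply/ffunP => i; rewrite !ffunE scaler_sumr -big_split/=.
by apply: eq_bigr => j _; rewrite !ffunE scalerDr !scalerA mulrC.
Qed.

Lemma mact_linearl m n a (M N : 'M[R]_(m, n)) x :
  mact (a *: M + N) x = a *: mact M x + mact N x.
Proof.
apply/ffunP => i; rewrite !ffunE scaler_sumr -big_split/=.
by apply: eq_bigr => j _; rewrite !mxE scalerDl scalerA.
Qed.

Lemma mactD m n (M : 'M[R]_(m, n)) x y : mact M (x + y) = mact M x + mact M y.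
Proof. by have := mact_linear M 1 x y; rewrite !scale1r. Qed.

Lemma mact0 m n (M : 'M[R]_(m, n)) : mact M 0 = 0.
Proof. by apply: (@addIr _ (mact M 0)); rewrite -mactD !add0r. Qed.

Lemma mactZ m n (M : 'M[R]_(m, n)) a x : mact M (a *: x) = a *: mact M x.
Proof. by have := mact_linear M a x 0; rewrite !addr0 mact0 addr0. Qed.

Lemma mactN m n (M : 'M[R]_(m, n)) x : mact M (- x) = - mact M x.
Proof. by rewrite -!scaleN1r mactZ. Qed.

Lemma mactNl m n (M : 'M[R]_(m, n)) x : mact (- M) x = - mact M x.
Proof.
by apply/ffunP => i; rewrite !ffunE -sumrN; apply: eq_bigr => j _; rewrite mxE scaleNr.
Qed.

(** The ranks of the powers of M cannot drop forever, so two consecutive powers have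
the same row space; N is then a one-sided substitute for the Drazin inverse of M. *)
Lemma exp_row_stable n (M : 'M[R]_n) : exists k (N : 'M[R]_n), M ^+ k = N *m M ^+ k.+1.
Proof.
suff [k /submxP[N NE]] : exists k, (M ^+ k <= M ^+ k.+1)%MS by exists k, N.
apply: contrapT => /forallNP no.
have rk k : (\rank (M ^+ k.+1) < \rank (M ^+ k))%N.
  have sub : (M ^+ k.+1 <= M ^+ k)%MS by rewrite exprS submxMl.
  by rewrite (ltn_leqif (mxrank_leqif_sup sub)); apply/negP/no.
have bound k : (\rank (M ^+ k) + k <= n)%N.
  elim: k => [|k ih]; first by rewrite addn0 rank_leq_row.
  by rewrite addnS (leq_trans _ ih)// ltn_add2r.
by have := bound n.+1; rewrite leqNgt (leq_trans (ltnSn n))// leq_addl.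
Qed.

Definition lift_op n (V : F -> F) (x : {ffun 'I_n -> F}) : {ffun 'I_n -> F} :=
  [ffun i => V (x i)].

Section LinearOperator.
Variable V : F -> F.
Hypothesis V_lin : forall a u v, V (a *: u + v) = a *: V u + V v.

Lemma linear_op0 : V 0 = 0.
Proof. by have := V_lin (-1) 0 0; rewrite scaler0 addr0 scaleN1r addNr. Qed.

Lemma linear_opN u : V (- u) = - V u.
Proof. by have := V_lin (-1) u 0; rewrite !addr0 linear_op0 addr0 !scaleN1r. Qed.

Lemma lift_op_linear n a (x y : {ffun 'I_n -> F}) :
  lift_op V (a *: x + y) = a *: lift_op V x + lift_op V y.
Proof. by apply/ffunP => i; rewrite !ffunE V_lin. Qed.

Lemma mact_lift m n (M : 'M[R]_(m, n)) x : lift_op V (mact M x) = mact M (lift_op V x).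
Proof.
apply/ffunP => i; rewrite !ffunE.
under [RHS]eq_bigr do rewrite ffunE.
elim/big_rec2: _ => [|j y1 y2 _ <-]; first exact: linear_op0.
exact: V_lin.
Qed.

Hypothesis V_inj : forall u, V u = 0 -> u = 0.
Hypothesis V_volterra : forall n (C : 'M[R]_n) z, z = mact C (lift_op V z) -> z = 0.

Lemma lift_op_inj n (x : {ffun 'I_n -> F}) : lift_op V x = 0 -> x = 0.
Proof.
by move=> /ffunP Vx; apply/ffunP => i; have := Vx i; rewrite !ffunE => /V_inj.
Qed.

(** Read V as integration: this is uniqueness for the differential-algebraic
equation E x = A (V x), whatever the index of the pencil.  The invertible part
of M = (l E - A)^-1 E is handled by V_volterra, the nilpotent part by V_inj. *)
Lemma pencil_volterra_unique n (E A : 'M[R]_n) (x : {ffun 'I_n -> F}) l :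
  \det (l *: E - A) != 0 -> mact E x = mact A (lift_op V x) -> x = 0.
Proof.
rewrite -unitfE -[_ \is a _]/(_ \in unitmx) => unitP ExAVx.
pose M := invmx (l *: E - A) *m E; pose xi := lift_op V x.
(* the equation, solved for V x by means of the resolvent of the pencil *)
have xiE : xi = mact M (l *: xi - x).
  rewrite /M mact_mul mactD mactZ mactN ExAVx -[in RHS]mactZ.
  have -> : mact E (l *: xi) - mact A (lift_op V x) = mact (l *: E - A) xi.
    by rewrite mact_linearl mactZ mactNl.
  by rewrite -mact_mul mulVmx// mact1.
have [k [N MN]] := exp_row_stable M.
have step j : mact (M ^+ j) xi = mact (M ^+ j.+1) (l *: xi - x).
  by rewrite exprSr -[_ * M]/(_ *m M) mact_mul -xiE.
have : mact (M ^+ k) x = 0.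
  apply: (@V_volterra n (l *: 1%:M - N)); rewrite mact_lift -/xi.
  rewrite mact_linearl mact1 mactNl [mact _ xi in X in _ - X]step -mact_mul -MN.
  by rewrite mactD mactZ mactN opprD addrA subrr add0r opprK.
(* descent: M^(j+1) x = 0 gives V (M^j x) = M^(j+1) (l V x - x) = 0 *)
elim: k {MN} => [|j ih]; first by rewrite expr0 mact1.
move=> Mx; apply: ih; apply: lift_op_inj; rewrite mact_lift step mactD mactZ mactN.
have -> : mact (M ^+ j.+1) (lift_op V x) = 0.
  by rewrite -mact_lift Mx; apply/ffunP => i; rewrite !ffunE linear_op0.
by rewrite Mx scaler0 oppr0 addr0.
Qed.
End LinearOperator.
End MatrixAction.

(** * Riesz representation on the range of an operator *)

Section InnerProduct.
Context (R : realType) (F : lmodType R) (dot : F -> F -> R).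
Hypothesis dotL : forall a u v w, dot (a *: u + v) w = a * dot u w + dot v w.
Hypothesis dotC : forall u v, dot u v = dot v u.
Hypothesis dot_ge0 : forall u, 0 <= dot u u.

Lemma dotDl u v w : dot (u + v) w = dot u w + dot v w.
Proof. by have := dotL 1 u v w; rewrite scale1r mul1r. Qed.

Lemma dot0l w : dot 0 w = 0.
Proof. by apply: (@addrI _ (dot 0 w)); rewrite -dotDl !addr0. Qed.

Lemma dotZl a u w : dot (a *: u) w = a * dot u w.
Proof. by have := dotL a u 0 w; rewrite !addr0 dot0l addr0. Qed.

Lemma dotNl u w : dot (- u) w = - dot u w.
Proof. by rewrite -scaleN1r dotZl mulN1r. Qed.

Lemma dotBl u v w : dot (u - v) w = dot u w - dot v w.
Proof. by rewrite dotDl dotNl. Qed.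

Lemma dotDr u v w : dot w (u + v) = dot w u + dot w v.
Proof. by rewrite dotC dotDl !(dotC w). Qed.

Lemma dotZr a u w : dot w (a *: u) = a * dot w u.
Proof. by rewrite dotC dotZl (dotC w). Qed.

Lemma dotBr u v w : dot w (u - v) = dot w u - dot w v.
Proof. by rewrite dotC dotBl !(dotC w). Qed.

(** The discriminant criterion, used twice: for the Cauchy-Schwarz inequality and for
the first variation at an almost minimiser. *)
Lemma quadratic_ge0_discr (a b c : R) : 0 <= a ->
  (forall s, 0 <= a * s ^+ 2 + 2 * b * s + c) -> b ^+ 2 <= a * c.
Proof.
rewrite le_eqVlt => /predU1P[<- h|a0 h].
  have [->|b0] := eqVneq b 0; first by rewrite expr0n/= mul0r.
  have := h (- (c + 1) / (2 * b)).
  rewrite mul0r add0r mulrCA divff ?mulf_neq0 ?pnatr_eq0// mulr1.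
  have -> : - (c + 1) + c = - 1 by ring.
  by rewrite oppr_ge0 ler10.
have := h (- b / a).
have -> : a * (- b / a) ^+ 2 + 2 * b * (- b / a) + c = (a * c - b ^+ 2) / a.
  by field; rewrite gt_eqF.
by rewrite ler_pdivlMr// mul0r subr_ge0.
Qed.

Lemma dot_cauchy_schwarz u v : dot u v ^+ 2 <= dot u u * dot v v.
Proof.
apply: quadratic_ge0_discr => // s.
have := dot_ge0 (s *: u + v).
by rewrite dotDl !dotDr !dotZl !dotZr (dotC v u); congr (_ <= _); ring.
Qed.

Definition nrm u := Num.sqrt (dot u u).

Lemma nrm_ge0 u : 0 <= nrm u.
Proof. exact: sqrtr_ge0. Qed.

Lemma nrm_sqr u : nrm u ^+ 2 = dot u u.
Proof. exact: sqr_sqrtr (dot_ge0 u). Qed.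

Lemma dot_le_nrm u v : `|dot u v| <= nrm u * nrm v.
Proof.
by rewrite -sqrtr_sqr -sqrtrM// ler_wsqrtr// dot_cauchy_schwarz.
Qed.

Lemma nrm_triangle u v : nrm (u + v) <= nrm u + nrm v.
Proof.
rewrite -(@ler_pXn2r _ 2)// ?nnegrE ?addr_ge0 ?nrm_ge0//.
rewrite nrm_sqr dotDl !dotDr (dotC v u) sqrrD !nrm_sqr.
have := le_trans (ler_norm _) (dot_le_nrm u v).
lra.
Qed.

Section Riesz.
Hypothesis complete : forall g : nat -> F,
  (forall k, nrm (g k.+1 - g k) <= 2^-1 ^+ k) ->
  exists x c, forall k, nrm (g k - x) <= c * 2^-1 ^+ k.
Variables (G : lmodType R) (W : set G) (B : G -> F) (f : G -> R) (C : R).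
Hypothesis W0 : W 0.
Hypothesis W_lin : forall a u v, W u -> W v -> W (a *: u + v).
Hypothesis B_lin : forall a u v, W u -> W v -> B (a *: u + v) = a *: B u + B v.
Hypothesis f_lin : forall a u v, W u -> W v -> f (a *: u + v) = a * f u + f v.
Hypothesis f_bounded : forall u, W u -> `|f u| <= C * nrm (B u).

Let J u := dot (B u) (B u) - 2 * f u.

Let J_ge u : W u -> - C ^+ 2 <= J u.
Proof.
move=> Wu; have := le_trans (ler_norm _) (f_bounded Wu).
rewrite /J -nrm_sqr => h; have := sqr_ge0 (nrm (B u) - C); nra.
Qed.

Let JW := [set J u | u in W].

Let JW_inf : has_inf JW.
Proof.
split; first by exists (J 0); exists 0.
by exists (- C ^+ 2) => _ [u Wu <-]; exact: J_ge.
Qed.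

Let m := inf JW.

Let m_le u : W u -> m <= J u.
Proof. by move=> Wu; apply: ge_inf; [exact: JW_inf.2|exists u]. Qed.

Let J_perturb a y u : W y -> W u ->
  J (a *: y + u) = J u + 2 * a * (dot (B u) (B y) - f y) + a ^+ 2 * dot (B y) (B y).
Proof.
move=> Wy Wu; rewrite /J B_lin// f_lin// dotDl !dotDr !dotZl !dotZr (dotC (B y) (B u)).
ring.
Qed.

(** Moving from u in the direction y changes J by a quadratic polynomial that stays above
- e; its discriminant gives the estimate. *)
Let almost_stationary e y u : W u -> J u <= m + e -> W y ->
  (dot (B u) (B y) - f y) ^+ 2 <= dot (B y) (B y) * e.
Proof.
move=> Wu Ju Wy; apply: quadratic_ge0_discr => // s.
have := m_le (W_lin s Wy Wu); rewrite J_perturb//.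
nra.
Qed.

(** The parallelogram identity, applied to the midpoint of u and v. *)
Let almost_minimizers_close e u v : W u -> W v ->
  J u <= m + e -> J v <= m + e -> dot (B u - B v) (B u - B v) <= 4 * e.
Proof.
move=> Wu Wv Ju Jv.
have Wuv : W (u - v) by rewrite addrC -scaleN1r; exact: W_lin.
have Buv : B (u - v) = B u - B v.
  by rewrite addrC -scaleN1r B_lin// scaleN1r addrC.
have Wm : W (- 2^-1 *: (u - v) + u) by exact: W_lin.
have fuv : f (u - v) = f u - f v by rewrite addrC -scaleN1r f_lin// mulN1r addrC.
have := m_le Wm; rewrite J_perturb// fuv Buv.
rewrite /J in Ju Jv *; rewrite !dotBr !dotBl (dotC (B v) (B u)).
lra.
Qed.

(** The minimisation of |B y|^2 - 2 f(y) over W yields the representing vector and, at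
the same time, its approximation by elements of the range; the latter is what
turns uniqueness of the representing vector into density of the range. *)
Lemma riesz_range : exists x, (forall y, W y -> dot x (B y) = f y) /\
  (forall e, 0 < e -> exists2 y, W y & nrm (B y - x) <= e).
Proof.
pose q k : R := 2^-1 ^+ k.
have q0 k : 0 < q k by rewrite exprn_gt0.
have qS k : q k.+1 = 2^-1 * q k by rewrite /q exprS.
have /choice[y yP] k : exists u, W u /\ J u <= m + q k ^+ 2 / 4.
  have e0 : 0 < q k ^+ 2 / 4 by rewrite divr_gt0// exprn_gt0.
  have [_ [u Wu <-] Ju] := inf_adherent e0 JW_inf.
  by exists u; split => //; exact: ltW.
have [x [c xc]] : exists x c, forall k, nrm (B (y k) - x) <= c * q k.
  apply: complete => k; rewrite -(@ler_pXn2r _ 2)// ?nnegrE ?nrm_ge0 ?(ltW (q0 k))//.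
  rewrite nrm_sqr -[leRHS]/(q k ^+ 2).
  have [Wk Jk] := yP k; have [WS JS] := yP k.+1.
  have := @almost_minimizers_close (q k ^+ 2 / 4) _ _ WS Wk _ Jk.
  rewrite mulrCA divff ?mulr1; last by rewrite pnatr_eq0.
  apply; apply: (le_trans JS); rewrite lerD2l qS.
  by have := sqr_ge0 (q k); nra.
(* a constant that is at least 1, so that it also absorbs the error of stationarity *)
pose D := `|c| + 1.
have D0 : 0 < D by rewrite ltr_wpDl.
have xP k : nrm (B (y k) - x) <= D * q k.
  apply: (le_trans (xc k)); rewrite ler_wpM2r ?(ltW (q0 k))//.
  by rewrite (le_trans (ler_norm c))// lerDl.
have small e : 0 < e -> exists k, D * q k <= e.
  move=> e0; have := @cvg_expr R 2^-1.
  rewrite ger0_norm// invf_lt1// ltr1n => /(_ erefl).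
  move=> /cvgrPdist_lt /(_ (e / D)); rewrite divr_gt0// => /(_ erefl) [k _ /(_ k)].
  rewrite /= leqnn sub0r normrN gtr0_norm ?q0// => /(_ erefl) qk.
  by exists k; rewrite -ler_pdivlMl// mulrC ltW.
exists x; split; last first.
  move=> e /small[k qk]; exists (y k); first exact: (yP k).1.
  exact: le_trans qk.
move=> z Wz; apply/eqP; rewrite -subr_eq0 -normr_le0; apply/ler_addgt0Pr => e e0.
rewrite add0r.
have N1 : 0 < nrm (B z) + 1 by rewrite ltr_wpDl// nrm_ge0.
have [k qk] : exists k, D * q k <= e / (nrm (B z) + 1) / 2.
  by apply: small; rewrite !divr_gt0.
have [Wk Jk] := yP k.
have d1 : `|dot (B (y k)) (B z) - f z| <= q k * nrm (B z).
  have := almost_stationary Wk Jk Wz => /le_trans le_dist.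
  rewrite -(@ler_pXn2r _ 2)// ?nnegrE ?mulr_ge0 ?nrm_ge0 ?(ltW (q0 k))//.
  rewrite real_normK ?num_real// exprMn nrm_sqr; apply: le_dist.
  by have := mulr_ge0 (dot_ge0 (B z)) (sqr_ge0 (q k)); lra.
have d2 : `|dot (B (y k) - x) (B z)| <= D * q k * nrm (B z).
  by apply: le_trans (dot_le_nrm _ _) _; rewrite ler_wpM2r ?nrm_ge0.
have -> : dot x (B z) - f z = (dot (B (y k)) (B z) - f z) - dot (B (y k) - x) (B z).
  by rewrite dotBl; ring.
apply: (le_trans (ler_normB _ _)).
have : D * q k * nrm (B z) <= e / 2.
  apply: (@le_trans _ _ (D * q k * (nrm (B z) + 1))).
    by rewrite ler_wpM2l ?lerDl// mulr_ge0 ?(ltW D0) ?(ltW (q0 k)).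
  by rewrite -ler_pdivlMr// mulrAC.
have D1 : 1 <= D by rewrite lerDr.
have := mulr_ge0 (ltW (q0 k)) (nrm_ge0 (B z)); nra.
Qed.

End Riesz.
End InnerProduct.

(** * Square-integrable functions on the interval *)

Section SquareIntegrable.
Context (R : realType) (T : R).
Local Notation mu := (@lebesgue_measure R).
Local Notation muI := (lebesgueI T).
Local Notation I := [set` `]0, T[].

Lemma measurable_I : measurable (I : set (measurableTypeR R)).
Proof. exact: measurable_itv. Qed.
Local Hint Resolve measurable_I : core.

(** Translates between the restricted measure that defines L2 and Lebesgue measure
relative to the interval, in which the integrals are written. *)
Lemma lebesgueI_ae (P : R -> Prop) :
  (\forall x \ae muI, P x) <-> (\forall x \ae mu, I x -> P x).
Proof.
split => -[B [mB B0 sub]].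
  exists (B `&` I); split; [exact: measurableI|exact: B0|].
  by move=> x /= /not_implyP[Ix Px]; split => //; exact: sub.
have B1 : measurable (B `|` ~` I : set (measurableTypeR R)).
  by apply: measurableU => //; exact: measurableC.
exists (B `|` ~` I); split => //.
  rewrite /lebesgueI /= /mrestr setIUl setICl setU0.
  apply/eqP; rewrite eq_le measure_ge0 andbT -B0 le_measure ?inE//.
  exact: measurableI.
move=> x /= Px; have [Ix|] := pselect (I x); last by right.
by left; apply: sub => /= IP; exact/Px/IP.
Qed.

Lemma integral_lebesgueI (f : R -> \bar R) :
  (\int[muI]_(x in I) f x = \int[mu]_(x in I) f x)%E.
Proof.
by apply: eq_measure_integral => A mA /setIidl AI; rewrite /lebesgueI/= /mrestr AI.
Qed.

Lemma integrable_lebesgueI (f : R -> \bar R) :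
  muI.-integrable I f <-> mu.-integrable I f.
Proof.
by split => /integrableP[mf fi]; apply/integrableP; split => //;
  [rewrite -integral_lebesgueI|rewrite integral_lebesgueI].
Qed.

Lemma ae_mono (P Q : R -> Prop) : (forall x, P x -> Q x) ->
  (\forall x \ae mu, P x) -> \forall x \ae mu, Q x.
Proof. by move=> PQ; apply: filterS => //; exact: (ae_filter_ringOfSetsType mu). Qed.

Lemma ae_mono2 (P Q S : R -> Prop) : (forall x, P x -> Q x -> S x) ->
  (\forall x \ae mu, P x) -> (\forall x \ae mu, Q x) -> \forall x \ae mu, S x.
Proof.
move=> PQS; apply: filterS2 => //; exact: (ae_filter_ringOfSetsType mu).
Qed.

(** Only the values on the interval matter, hence the truncation. *)
Definition sqint (f : R -> R) : Prop := f \_ I \in Lfun muI 2%:E.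

Lemma sqintP (f : R -> R) : sqint f <->
  measurable_fun (I : set (measurableTypeR R)) f /\
  mu.-integrable I (fun x => (f x ^+ 2)%:E).
Proof.
split.
  move=> fs; have := fs => /andP[/set_mem mf _]; split.
    exact/(measurable_restrictT _ measurable_I).
  have /(integrableS measurableT measurable_I (@subsetT _ _)) := Lfun2_integrable_sqr fs.
  move/integrable_lebesgueI; apply: eq_integrable => // x xI.
  by rewrite /= patchE xI.
move=> [mf fi]; apply/andP; split; rewrite inE/=.
  exact/(measurable_restrictT _ measurable_I).
rewrite /finite_norm unlock /Lnorm poweR_lty//.
have -> : (\int[muI]_x (`|(f \_ I) x| `^ 2)%:E = \int[mu]_(x in I) (f x ^+ 2)%:E)%E.
  rewrite -integral_lebesgueI [RHS]integral_mkcond; apply: eq_integral => x _.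
  rewrite !patchE; case: ifP => _; last by rewrite normr0 powR0.
  by rewrite powR_mulrn ?normr_ge0// real_normK// num_real.
exact: integrable_lty.
Qed.

Lemma sqint_meas (f : R -> R) : sqint f -> measurable_fun (I : set (measurableTypeR R)) f.
Proof. by move=> /sqintP[]. Qed.

Lemma sqint_mul f g : sqint f -> sqint g -> mu.-integrable I (EFin \o (f \* g)).
Proof.
move=> fs gs; have /Lfun1_integrable := Lfun2_mul_Lfun1 fs gs.
move=> /(integrableS measurableT measurable_I (@subsetT _ _)) /integrable_lebesgueI.
by apply: eq_integrable => // x xI; rewrite /= !patchE xI.
Qed.

Lemma sqint_lin a f g : sqint f -> sqint g -> sqint (fun x => a * f x + g x).
Proof.
move=> fs gs; rewrite /sqint.
have -> : (fun x => a * f x + g x) \_ I = a *: (f \_ I) + g \_ I.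
  apply/funext => x; rewrite !fctE !patchE; case: ifP => _ //.
  by rewrite scaler0 addr0.
exact: Lfun_lin (lee1n 2) _ _ _ fs gs.
Qed.

Lemma sqint0 : sqint (fun=> 0).
Proof.
rewrite /sqint; have -> : (fun=> 0 : R) \_ I = 0 by apply/funext => x; rewrite patchE if_same.
exact: (Lfun0 muI (lee1n 2)).
Qed.

Lemma sqintZ a f : sqint f -> sqint (fun x => a * f x).
Proof.
move=> fs; have := sqint_lin a fs sqint0.
by congr sqint; apply/funext => x; rewrite addr0.
Qed.

Lemma sqintD f g : sqint f -> sqint g -> sqint (fun x => f x + g x).
Proof.
move=> fs gs; have := sqint_lin 1 fs gs.
by congr sqint; apply/funext => x; rewrite mul1r.
Qed.

Lemma sqint_norm f : sqint f -> sqint (fun x => `|f x|).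
Proof.
move=> /sqintP[mf fi]; apply/sqintP; split; first exact: measurableT_comp.
by apply: eq_integrable fi => // x _; rewrite real_normK// num_real.
Qed.

Lemma sqint_sum (J : Type) (s : seq J) (f : J -> R -> R) :
  (forall j, sqint (f j)) -> sqint (fun x => \sum_(j <- s) f j x).
Proof.
move=> fs; elim: s => [|j s ih].
  by have := sqint0; congr sqint; apply/funext => x; rewrite big_nil.
by have := sqintD (fs j) ih; congr sqint; apply/funext => x; rewrite big_cons.
Qed.

Lemma lebesgue_I_lty : (mu I < +oo)%E.
Proof. by rewrite lebesgue_measure_itv/=; case: ifP => _; rewrite ltry. Qed.

Lemma sqint_bounded (f : R -> R) (M : R) : measurable_fun (I : set (measurableTypeR R)) f ->
  (forall t, I t -> `|f t| <= M) -> sqint f.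
Proof.
move=> mf fM; apply/sqintP; split => //.
apply: (@measurable_bounded_integrable _ _ _ mu (fun x => f x ^+ 2)) => //.
- exact: lebesgue_I_lty.
- exact: measurable_funX.
exists (M ^+ 2); split; first exact: num_real.
move=> N MN x Ix /=; rewrite normrX; apply: le_trans (ltW MN).
by rewrite lerXn2r ?nnegrE ?fM// (le_trans _ (fM _ Ix)).
Qed.

Lemma sqint_cst c : sqint (fun=> c).
Proof. exact: (@sqint_bounded _ `|c|). Qed.

Lemma sqint_integrable f : sqint f -> mu.-integrable I (EFin \o f).
Proof.
move=> fs; have := sqint_mul fs (sqint_cst 1).
by apply: eq_integrable => // x _; rewrite /= mulr1.
Qed.

Lemma sqint_L2 (u : L2 T) : sqint (L2fun u).
Proof.
have us := Lspace_Lfun u.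
have /andP[/set_mem mu_ _] := us.
apply/sqintP; split; first exact: measurable_funTS.
have /(integrableS measurableT measurable_I (@subsetT _ _)) := Lfun2_integrable_sqr us.
by move/integrable_lebesgueI.
Qed.
Local Hint Resolve sqint_L2 : core.

Definition aeI (f g : R -> R) : Prop := \forall x \ae mu, I x -> f x = g x.

Lemma L2_eq (u v : L2 T) : aeI (L2fun u) (L2fun v) -> u = v.
Proof.
move=> /lebesgueI_ae uv; apply/Lspace_eqP; apply: filterS uv => x + _.
exact.
Qed.

Lemma L2fun_lin a (u v : L2 T) :
  aeI (L2fun (a *: u + v)) (fun x => a * L2fun u x + L2fun v x).
Proof.
apply/lebesgueI_ae.
apply: filterS2 (Lspace_scaleE a (u : LspaceType _ _))
  (Lspace_addE ((a *: u : L2 T) : LspaceType _ _) v) => x.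
by rewrite /L2fun => <- <-.
Qed.

(** A total version of the class of a function, with value 0 outside L2, so that
operators on functions can be lifted without carrying integrability proofs. *)
Definition L2of (f : R -> R) : L2 T :=
  match pselect (sqint f) with
  | left fs => Lclass (lee1n 2) fs
  | right _ => 0
  end.

Lemma L2ofE f : sqint f -> aeI (L2fun (L2of f)) f.
Proof.
rewrite /L2of; case: pselect => // fs _.
have /lebesgueI_ae : \forall x \ae muI, (Lclass (lee1n 2) fs : R -> R) x = (f \_ I) x.
  by apply: filterS (LclassE (lee1n 2) fs) => x; exact.
by apply: ae_mono => x + Ix => /(_ Ix); rewrite patchE mem_set.
Qed.

Lemma aeI_refl f : aeI f f.
Proof. exact: aeW. Qed.
Local Hint Resolve aeI_refl : core.

Lemma aeI_sym f g : aeI f g -> aeI g f.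
Proof. by apply: ae_mono => x fg Ix; rewrite fg. Qed.

Lemma aeI_trans f g h : aeI f g -> aeI g h -> aeI f h.
Proof. by apply: ae_mono2 => x fg gh Ix; rewrite fg// gh. Qed.

Lemma aeI_comp2 (op : R -> R -> R) f g f' g' : aeI f f' -> aeI g g' ->
  aeI (fun x => op (f x) (g x)) (fun x => op (f' x) (g' x)).
Proof. by apply: ae_mono2 => x ff gg Ix; rewrite ff// gg. Qed.

Lemma L2of_eq f (u : L2 T) : sqint f -> aeI (L2fun u) f -> u = L2of f.
Proof. by move=> fs uf; apply: L2_eq; apply: aeI_trans uf (aeI_sym (L2ofE fs)). Qed.

Lemma L2fun0 : aeI (L2fun (0 : L2 T)) (fun=> 0).
Proof. by apply/lebesgueI_ae; exact: (Lspace_zeroE muI (lee1n 2)). Qed.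

Lemma L2funZ a (u : L2 T) : aeI (L2fun (a *: u)) (fun x => a * L2fun u x).
Proof.
rewrite -[a *: u]addr0; apply: aeI_trans (L2fun_lin _ _ _) _.
by apply: ae_mono L2fun0 => x u0 Ix; rewrite u0// addr0.
Qed.

Lemma L2funD (u v : L2 T) : aeI (L2fun (u + v)) (fun x => L2fun u x + L2fun v x).
Proof.
rewrite -[u in u + v]scale1r; apply: aeI_trans (L2fun_lin _ _ _) _.
by apply: aeW => x Ix; rewrite mul1r.
Qed.

Lemma L2funB (u v : L2 T) : aeI (L2fun (u - v)) (fun x => L2fun u x - L2fun v x).
Proof.
apply: aeI_trans (L2funD _ _) _; rewrite -scaleN1r.
by apply: ae_mono (L2funZ (-1) v) => x h Ix; rewrite h// mulN1r.
Qed.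

Lemma L2fun_sum (J : Type) (s : seq J) (c : J -> R) (u : J -> L2 T) :
  aeI (L2fun (\sum_(j <- s) c j *: u j)) (fun x => \sum_(j <- s) c j * L2fun (u j) x).
Proof.
elim: s => [|j s ih].
  by rewrite big_nil; apply: ae_mono L2fun0 => x u0 Ix; rewrite big_nil u0.
rewrite big_cons; apply: aeI_trans (L2fun_lin _ _ _) _.
by apply: ae_mono ih => x h Ix; rewrite h// big_cons.
Qed.

Lemma aeI_sum (J : Type) (s : seq J) (f g : J -> R -> R) :
  (forall j, aeI (f j) (g j)) ->
  aeI (fun x => \sum_(j <- s) f j x) (fun x => \sum_(j <- s) g j x).
Proof.
move=> fg; elim: s => [|j s ih]; first by apply: aeW => x _; rewrite !big_nil.
by apply: ae_mono2 (fg j) ih => x h1 h2 Ix; rewrite !big_cons h1// h2.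
Qed.

Definition dotI (f g : R -> R) : R := \int[mu]_(t in I) (f t * g t).
Definition ip (u v : L2 T) : R := dotI (L2fun u) (L2fun v).

Lemma dotI_ae f g f' g' : sqint f -> sqint g -> sqint f' -> sqint g' ->
  aeI f f' -> aeI g g' -> dotI f g = dotI f' g'.
Proof.
move=> fs gs fs' gs' ff gg; congr fine; apply: ae_eq_integral => //.
- by apply/measurable_EFinP; apply: measurable_funM; exact: sqint_meas.
- by apply/measurable_EFinP; apply: measurable_funM; exact: sqint_meas.
- by apply: ae_mono (aeI_comp2 *%R ff gg) => x h Ix; rewrite h.
Qed.

Lemma dotIC f g : dotI f g = dotI g f.
Proof. by rewrite /dotI; under eq_Rintegral do rewrite mulrC. Qed.

Lemma dotI_lin a f g h : sqint f -> sqint g -> sqint h ->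
  dotI (fun x => a * f x + g x) h = a * dotI f h + dotI g h.
Proof.
move=> fs gs hs; rewrite /dotI.
rewrite -RintegralZl//; last exact: sqint_mul.
rewrite -RintegralD//; last exact: sqint_mul.
  by apply: eq_Rintegral => x _; rewrite mulrDl mulrA.
have := sqint_mul (sqintZ a fs) hs.
by apply: eq_integrable => // x _ /=; rewrite mulrA.
Qed.

Lemma ipL a u v w : ip (a *: u + v) w = a * ip u w + ip v w.
Proof.
rewrite -dotI_lin//; apply: dotI_ae => //; last exact: L2fun_lin.
exact: sqint_lin.
Qed.

Lemma ipC u v : ip u v = ip v u.
Proof. exact: dotIC. Qed.

Lemma ip_ge0 u : 0 <= ip u u.
Proof. by apply: Rintegral_ge0 => x _; rewrite -expr2 sqr_ge0. Qed.

Lemma Rintegral_eq0_ae g : mu.-integrable I (EFin \o g) -> (forall x, I x -> 0 <= g x) ->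
  \int[mu]_(t in I) g t = 0 -> aeI g (fun=> 0).
Proof.
move=> gi g_ge0 g0.
have : (\int[mu]_(x in I) `|(g x)%:E| = 0)%E.
  rewrite -[LHS]fineK.
    congr EFin; rewrite -[RHS]g0; congr fine; apply: eq_integral => x.
    by rewrite inE => Ix; rewrite gee0_abs ?lee_fin ?g_ge0.
  rewrite ge0_fin_numE; last exact: integral_ge0.
  by move/integrableP : gi => -[].
have mg : measurable_fun (I : set (measurableTypeR R)) (EFin \o g).
  by case/integrableP : gi.
by move/(ae_eq_integral_abs mu measurable_I mg); apply: ae_mono => x h Ix; have [] := h Ix.
Qed.

Lemma dotI_eq0 f : sqint f -> dotI f f = 0 -> aeI f (fun=> 0).
Proof.
move=> fs; move/(Rintegral_eq0_ae (sqint_mul fs fs)) => ff.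
apply: ae_mono (ff _) => [x + Ix|x _]; last by rewrite /= -expr2 sqr_ge0.
by move=> /(_ Ix)/eqP; rewrite mulf_eq0 orbb => /eqP.
Qed.

Lemma ip_eq0 u : ip u u = 0 -> u = 0.
Proof.
move=> /(dotI_eq0 (sqint_L2 u)) u0; apply: L2_eq.
exact: aeI_trans u0 (aeI_sym L2fun0).
Qed.

Lemma ip_L2ofr u f : sqint f -> ip u (L2of f) = dotI (L2fun u) f.
Proof. by move=> fs; apply: dotI_ae => //; exact: L2ofE. Qed.

Lemma ip_L2of f g : sqint f -> sqint g -> ip (L2of f) (L2of g) = dotI f g.
Proof. by move=> fs gs; apply: dotI_ae => //; exact: L2ofE. Qed.

Lemma L2of_lin a f g : sqint f -> sqint g ->
  L2of (fun x => a * f x + g x) = a *: L2of f + L2of g.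
Proof.
move=> fs gs; apply/esym/L2of_eq; first exact: sqint_lin.
apply: aeI_trans (L2fun_lin _ _ _) _.
exact: (aeI_comp2 (fun x y => a * x + y)) (L2ofE fs) (L2ofE gs).
Qed.

End SquareIntegrable.
#[export] Hint Resolve measurable_I sqint_L2 aeI_refl : core.

(** * The two Volterra integrals *)

Section Volterra.
Context (R : realType) (T : R).
Local Notation mu := (@lebesgue_measure R).
Local Notation I := [set` `]0, T[].

Local Notation sqint := (sqint T).
Local Notation aeI := (aeI T).
Local Notation dotI := (dotI T).

Lemma patch0E (D : set R) (f : R -> R) x :
  (f \_ D) x = if x \in D then f x else 0.
Proof. by rewrite patchE. Qed.

Lemma integrable_patchI (f : R -> R) : mu.-integrable I (EFin \o f) ->
  mu.-integrable setT (EFin \o (f \_ I)).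
Proof.
move=> /(integrable_mkcond _ (measurable_I T)).1; apply: eq_integrable => // x _.
by rewrite /= restrict_EFin.
Qed.

Lemma sqint_patch (f : R -> R) (D : set R) : measurable D -> sqint f ->
  mu.-integrable D (EFin \o (f \_ I)).
Proof.
move=> mD /sqint_integrable/integrable_patchI.
exact: integrableS.
Qed.

(** Truncating the integrand makes it integrable on the whole line, so that no
side condition on t is needed. *)
Definition primitive0 (f : R -> R) (t : R) : R := \int[mu]_(s in `[0, t]) (f \_ I) s.
(** The integral from t to T, written as a difference; see primitiveT_ltE for the
integral form. *)
Definition primitiveT (f : R -> R) (t : R) : R := \int[mu]_(s in I) f s - primitive0 f t.

Lemma primitive0_ltE f t : sqint f ->
  primitive0 f t = \int[mu]_s (if s < t then (f \_ I) s else 0).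
Proof.
move=> fs; rewrite /primitive0 -Rintegral_itv_bndo_bndc; last exact: sqint_patch.
rewrite Rintegral_mkcond; apply: eq_Rintegral => s _; rewrite !patch0E.
rewrite mem_setE in_itv/=; case: (ltP s t) => st; rewrite ?andbF// andbT.
case: ifP => //; case: ifPn => //; rewrite inE/= in_itv/= => /andP[s0 _].
by rewrite ltW.
Qed.

Lemma primitiveT_ltE f s : sqint f ->
  primitiveT f s = \int[mu]_t (if s < t then (f \_ I) t else 0).
Proof.
move=> fs; rewrite /primitiveT /primitive0 Rintegral_mkcond [X in _ - X]Rintegral_mkcond.
rewrite -RintegralB//; last 2 first.
- exact: sqint_patch.
- have mD : measurable (`[0, s]%classic : set (measurableTypeR R)) by exact: measurable_itv.
  have /(integrable_mkcond _ mD) := sqint_patch mD fs.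
  by apply: eq_integrable => // x _; rewrite /= restrict_EFin.
apply: eq_Rintegral => t _; rewrite !patch0E !mem_setE !in_itv/=.
case: (ltP s t) => st; first by rewrite andbF subr0.
rewrite andbT; case: ifPn => t0; case: ifPn => //; rewrite ?subrr//.
by case/andP: t0 => /ltW ->.
Qed.

(** Fubini's theorem for the kernel f(s) g(t) on the triangle s < t. *)
Lemma primitive0_adjoint f g : sqint f -> sqint g ->
  dotI (primitive0 f) g = dotI f (primitiveT g).
Proof.
move=> fs gs.
pose F := f \_ I; pose G := g \_ I.
have iF : mu.-integrable setT (EFin \o F) by exact: sqint_patch.
have iG : mu.-integrable setT (EFin \o G) by exact: sqint_patch.
have mF : measurable_fun setT F by case/integrableP : iF => /measurable_EFinP.
have mG : measurable_fun setT G by case/integrableP : iG => /measurable_EFinP.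
(* the first variable is t, the second s *)
pose k (p : R * R) := if p.2 < p.1 then F p.2 * G p.1 else 0.
have mk : measurable_fun setT k.
  apply: measurable_fun_ifT => //.
    by apply: measurable_fun_ltr.
  by apply: measurable_funM; exact: measurableT_comp.
have ik : (mu \x mu)%E.-integrable setT (EFin \o k).
  apply/integrable12ltyP; first exact/measurable_EFinP.
  apply: (@le_lt_trans _ _ (\int[mu]_t ((\int[mu]_s `|F s|%:E) * `|G t|%:E))%E).
    apply: ge0_le_integral => //.
    - by move=> t _; exact: integral_ge0.
    - apply: (@measurable_fun_fubini_tonelli_F _ _ _ _ _ mu (abse \o (EFin \o k))) => //=.
      by apply: measurableT_comp => //; exact/measurable_EFinP.
    - apply: emeasurable_funM => //; apply/measurable_EFinP.
      exact: measurableT_comp.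
    move=> t _; rewrite muleC -ge0_integralZl//; last first.
      by apply/measurable_EFinP; exact: measurableT_comp.
    apply: ge0_le_integral => //.
    - apply/measurable_EFinP; apply: measurableT_comp => //.
      by apply: (measurableT_comp mk) => //; exact: measurable_pair1.
    - apply: emeasurable_funM => //; apply/measurable_EFinP.
      exact: measurableT_comp.
    move=> s _; rewrite /k/= -EFinM lee_fin; case: ifP => _.
      by rewrite normrM mulrC.
    by rewrite normr0 mulr_ge0.
  rewrite ge0_integralZl//; last 2 first.
  - by apply/measurable_EFinP; exact: measurableT_comp.
  - exact: integral_ge0.
  apply: lte_mul_pinfty; rewrite ?integral_ge0 ?ge0_fin_numE//.
  - by case/integrableP : iF.
  - exact: integral_ge0.
  - by case/integrableP : iG.
have := @Fubini _ _ _ _ _ mu mu (EFin \o k) ik.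
have split_out (h : R -> R) (c : R) : mu.-integrable setT (EFin \o h) ->
    (((\int[mu]_s h s) * c)%:E = \int[mu]_s (h s * c)%:E)%E.
  move=> ih; rewrite -RintegralZr// fineK//; apply: integrable_fin_num => //.
  have := integrableZl measurableT c ih.
  by apply: eq_integrable => // x _; rewrite /= -EFinM mulrC.
have -> : dotI (primitive0 f) g = fine (\int[mu]_t \int[mu]_s (k (t, s))%:E)%E.
  rewrite /dotI Rintegral_mkcond; congr fine; apply: eq_integral => t _.
  transitivity ((primitive0 f t * G t)%:E).
    by rewrite /G !patch0E; case: ifP => _; rewrite ?mulr0.
  rewrite primitive0_ltE// -/F split_out//; last first.
    apply: (le_integrable _ _ _ iF) => //.
      apply/measurable_EFinP; apply: measurable_fun_ifT => //.
      exact: measurable_fun_ltr.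
    by move=> s _ /=; case: ifP => _; rewrite lee_fin ?normr0.
  apply: eq_integral => s _; rewrite /k/=; case: ifP => _ //.
  by rewrite mul0r.
have -> : dotI f (primitiveT g) = fine (\int[mu]_s \int[mu]_t (k (t, s))%:E)%E.
  rewrite /dotI Rintegral_mkcond; congr fine; apply: eq_integral => s _.
  transitivity ((primitiveT g s * F s)%:E).
    by rewrite /F !patch0E mulrC; case: ifP => _; rewrite ?mul0r ?mulr0.
  rewrite primitiveT_ltE// -/G split_out//; last first.
    apply: (le_integrable _ _ _ iG) => //.
      apply/measurable_EFinP; apply: measurable_fun_ifT => //.
      exact: measurable_fun_ltr.
    by move=> t _ /=; case: ifP => _; rewrite lee_fin ?normr0.
  apply: eq_integral => t _; rewrite /k/= mulrC; case: ifP => _ //.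
  by rewrite mulr0.
by move=> ->.
Qed.

Lemma primitive0_continuous f : 0 < T -> sqint f -> {within `[0, T], continuous (primitive0 f)}.
Proof.
move=> T0 fs; apply: parameterized_integral_continuous; first exact: ltW.
exact: sqint_patch.
Qed.

Lemma measurable_primitive0 f : 0 < T -> sqint f ->
  measurable_fun (I : set (measurableTypeR R)) (primitive0 f).
Proof.
move=> T0 fs; apply: (@measurable_funS _ _ _ _ `[0, T]%classic) => //.
- exact: subset_itv_oo_cc.
- apply: subspace_continuous_measurable_fun; first exact: measurable_itv.
  exact: primitive0_continuous.
Qed.

Lemma primitive0_le f t : sqint f -> `|primitive0 f t| <= primitive0 (fun x => `|f x|) t.
Proof.
move=> fs; apply: (le_trans (le_normr_Rintegral _ _)); first exact: measurable_itv.
  exact: sqint_patch.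
rewrite /primitive0 le_eqVlt; apply/orP; left; apply/eqP; apply: eq_Rintegral => s _.
by rewrite !patch0E; case: ifP => _; rewrite ?normr0.
Qed.

Lemma primitive0_ge0_le f t : sqint f -> (forall x, 0 <= f x) ->
  primitive0 f t <= \int[mu]_(s in I) f s.
Proof.
move=> fs f0; rewrite primitive0_ltE// [leRHS]Rintegral_mkcond; apply: le_Rintegral => //.
- have fi : mu.-integrable setT (EFin \o (f \_ I)) by exact: sqint_patch.
  apply: (le_integrable _ _ _ fi) => //.
    apply/measurable_EFinP; apply: measurable_fun_ifT => //.
      exact: measurable_fun_ltr.
    by case/integrableP : fi => /measurable_EFinP.
  by move=> s _ /=; case: ifP => _; rewrite lee_fin ?normr0.
- exact: sqint_patch.
- move=> s _; case: ifP => // _; rewrite patch0E; by case: ifP.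
Qed.

Lemma sqint_primitive0 f : 0 < T -> sqint f -> sqint (primitive0 f).
Proof.
move=> T0 fs.
apply: (@sqint_bounded _ _ _ (\int[mu]_(s in I) `|f s|)); first exact: measurable_primitive0.
move=> t It; apply: le_trans (primitive0_le _ fs) _.
by apply: primitive0_ge0_le => //; exact: sqint_norm.
Qed.

Lemma primitive0_ae f g t : sqint f -> sqint g -> aeI f g -> primitive0 f t = primitive0 g t.
Proof.
move=> fs gs fg; congr fine; apply: ae_eq_integral => //.
- by case/integrableP : (sqint_patch (measurable_itv `[0, t]) fs).
- by case/integrableP : (sqint_patch (measurable_itv `[0, t]) gs).
apply: ae_mono fg => x fgx _ /=; rewrite !patch0E; case: ifPn => //.
by rewrite inE => /fgx ->.
Qed.

Lemma primitive0_lin a f g t : sqint f -> sqint g ->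
  primitive0 (fun x => a * f x + g x) t = a * primitive0 f t + primitive0 g t.
Proof.
move=> fs gs; rewrite /primitive0 -RintegralZl; [|exact: measurable_itv|exact: sqint_patch].
rewrite -RintegralD; [|exact: measurable_itv| |exact: sqint_patch].
  apply: eq_Rintegral => x _; rewrite !patch0E; case: ifP => // _.
  by rewrite mulr0 addr0.
have := sqint_patch (measurable_itv `[0, t]) (sqintZ a fs).
apply: eq_integrable; first exact: measurable_itv.
by move=> x _ /=; rewrite !patch0E; case: ifP => // _; rewrite mulr0.
Qed.

End Volterra.

(** * The flat exponential *)

Section Mollifier.
Context (R : realType).

(** The family t^-k exp (- 1 / t), extended by 0: it is stable under derivation up to
linear combinations. *)
Definition flat_exp (k : nat) (t : R) : R := if 0 < t then t ^- k * expR (- t^-1) else 0.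

(** From u^(k+1) / (k+1)! <= exp u at u = 1 / t; linear decay at 0 gives both continuity
and differentiability there. *)
Lemma flat_exp_bound k t : `|flat_exp k t| <= k.+1`!%:R * `|t|.
Proof.
rewrite /flat_exp; case: ifPn => [t0|_]; last by rewrite normr0 mulr_ge0.
have tN0 : t != 0 by rewrite gt_eqF.
rewrite ger0_norm; last by rewrite mulr_ge0 ?expR_ge0 ?invr_ge0 ?exprn_ge0 ?(ltW t0).
rewrite gtr0_norm// expRN.
have := @expR_ge1Dxn R t^-1 k; rewrite invr_ge0 (ltW t0) => /(_ erefl) h.
have {}h : t^-1 ^+ k.+1 / k.+1`!%:R <= expR t^-1 by apply: le_trans h; rewrite lerDr.
rewrite ler_pdivrMr ?expR_gt0//.
have f0 : 0 < k.+1`!%:R :> R by rewrite ltr0n fact_gt0.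
apply: (@le_trans _ _ (k.+1`!%:R * t * (t^-1 ^+ k.+1 / k.+1`!%:R))).
  rewrite le_eqVlt; apply/orP; left; apply/eqP.
  by rewrite exprS exprVn; field; rewrite tN0 gt_eqF// expf_neq0.
by rewrite ler_wpM2l// mulr_ge0// ltW.
Qed.

(** At 0 this is Caratheodory's criterion, because flat_exp k t = t * flat_exp k.+1 t and
flat_exp k.+1 is continuous at 0. *)
Lemma is_derive_flat_exp (k : nat) (t : R) :
  is_derive t (1 : R) (flat_exp k) (flat_exp k.+2 t - k%:R * flat_exp k.+1 t).
Proof.
have [t0|t0|->] := ltgtP t 0.
- have -> : flat_exp k.+2 t - k%:R * flat_exp k.+1 t = 0.
    by rewrite /flat_exp ltNge (ltW t0)/= mulr0 subr0.
  apply: (@near_eq_is_derive _ _ _ (cst (0 : R))).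
  near=> x; rewrite /flat_exp ltNge (_ : x <= 0)//.
  by near: x; exact: lt_le_nbhsl.
- pose f (x : R) := x^-1 ^+ k * expR (- x^-1).
  apply: (@near_eq_is_derive _ _ _ f).
    near=> x; rewrite /flat_exp /f exprVn ifT//.
    by near: x; exact: lt_nbhsr.
  have tN0 : t != 0 by rewrite gt_eqF.
  have dV : is_derive t 1 (fun x : R => x^-1) (- t ^- 2).
    by have := is_deriveV tN0 (is_derive_id t 1); rewrite /GRing.scale/= mulr1.
  have dE : is_derive t 1 (fun x : R => expR (- x^-1)) (expR (- t^-1) * t ^- 2).
    have := @is_derive1_comp R expR (fun x => - x^-1) t _ _
      (is_derive_expR (- t^-1)) (is_deriveN dV).
    by rewrite opprK.
  have dX : is_derive t 1 (fun x : R => x^-1 ^+ k) (k%:R * t^-1 ^+ k.-1 * - t ^- 2).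
    have -> : (fun x : R => x^-1 ^+ k) = (fun x => x^-1) ^+ k.
      by apply/funext => x; rewrite exprfctE.
    exact: (is_deriveX k dV).
  apply: (is_derive_eq (is_deriveM dX dE)).
  rewrite /flat_exp t0 /GRing.scale/=.
  case: k {f dX} => [|k]; first by rewrite !mul0r mulr0 addr0 subr0 expr0 mul1r mulrC.
  by rewrite exprVn /= exprVn !exprS; field; rewrite tN0 expf_neq0.
- have m0 j : flat_exp j 0 = 0 by rewrite /flat_exp ltxx.
  apply/is_derive1_caratheodory; exists (flat_exp k.+1); split.
  + move=> z; rewrite m0 !subr0 /flat_exp; case: ifPn => [z0|_]; last by rewrite mul0r.
    by rewrite exprS; field; rewrite ?expf_neq0 ?gt_eqF.
  + rewrite /prop_for /continuous_at m0; apply/cvgrPdist_le => e e0.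
    have C0 : 0 < k.+2`!%:R :> R by rewrite ltr0n fact_gt0.
    exists (e / k.+2`!%:R) => /=; first by rewrite divr_gt0.
    move=> z; rewrite /= !sub0r !normrN => ze.
    by rewrite (le_trans (flat_exp_bound _ _))// -ler_pdivlMl// mulrC ltW.
  + by rewrite !m0 mulr0 subr0.
Unshelve. all: by end_near. Qed.

End Mollifier.

(** * Test functions *)

Section TestFunctions.
Context (R : realType) (T : R).
Local Notation mu := (@lebesgue_measure R).
Local Notation I := [set` `]0, T[].
Local Notation sqint := (sqint T).

(** An explicit class of functions that contains the bumps and is stable under
derivation, which yields smoothness to all orders at once. *)
Inductive bump_span : (R -> R) -> Prop :=
| bump_span_base (p q : {poly R}) (k : nat) : bump_span (fun t => p.[t] * flat_exp k q.[t])
| bump_span_add (f g : R -> R) : bump_span f -> bump_span g -> bump_span (fun t => f t + g t).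

Lemma bump_span_derive f : bump_span f ->
  exists f', bump_span f' /\ forall t : R, is_derive t (1 : R) f (f' t).
Proof.
elim=> [p q k|f1 f2 _ [g1 [m1 d1]] _ [g2 [m2 d2]]]; last first.
  exists (fun t => g1 t + g2 t); split; first exact: bump_span_add.
  by move=> t; exact: (is_deriveD (d1 t) (d2 t)).
exists (fun t => p^`().[t] * flat_exp k q.[t] +
  ((p * q^`()).[t] * flat_exp k.+2 q.[t] + (- k%:R *: (p * q^`())).[t] * flat_exp k.+1 q.[t])).
split; first by do 2 (apply: bump_span_add; first exact: bump_span_base); exact: bump_span_base.
move=> t.
have dq := @is_derive1_comp R (flat_exp k) (horner q) t _ _ (is_derive_flat_exp k q.[t])
  (is_derive_poly q t).
apply: (is_derive_eq (is_deriveM (is_derive_poly p t) dq)).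
rewrite !hornerE /GRing.scale/=; ring.
Qed.

Lemma bump_span_smooth f : bump_span f -> forall k t, derivable (derive1n k f) t 1.
Proof.
move=> fs k t.
suff /bump_span_derive[f' [_ /(_ t)[]]//] : bump_span (derive1n k f).
elim: k => [|k /bump_span_derive[f' [fs' fd]]]; first by rewrite derive1n0.
rewrite derive1nS (_ : derive1 (derive1n k f) = f')//.
by apply/funext => s; rewrite derive1E; have [] := fd s.
Qed.

Lemma bump_span_continuous f : bump_span f -> continuous f.
Proof.
move=> /bump_span_smooth/(_ 0) fd t; rewrite derive1n0 in fd.
exact/differentiable_continuous/derivable1_diffP.
Qed.

Lemma sqint_continuous f : {within `[0, T], continuous f} -> sqint f.
Proof.
move=> cf; have mT : measurable (`[0, T]%classic : set (measurableTypeR R)).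
  exact: measurable_itv.
have mf : measurable_fun (I : set (measurableTypeR R)) f.
  apply: (@measurable_funS _ _ _ _ `[0, T]%classic) => //.
    exact: subset_itv_oo_cc.
  exact: subspace_continuous_measurable_fun.
have /compact_bounded[M [_ fM]] := continuous_compact cf (@segment_compact _ 0 T).
apply: (@sqint_bounded _ _ _ (M + 1)) => // t It.
apply: fM; first by rewrite ltrDl.
by exists t => //; exact: subset_itv_oo_cc.
Qed.

Lemma sqint_contT f : continuous f -> sqint f.
Proof. by move=> cf; apply: sqint_continuous; exact: continuous_subspaceT. Qed.

(** The primitive from -oo vanishes before l, and also after r because the total integral
is 0. *)
Lemma bump_span_primitive_test h l r : bump_span h -> 0 < l -> r < T ->
  (forall t, t \notin `]l, r[ -> h t = 0) -> \int[mu]_(t in I) h t = 0 ->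
  exists2 phi, test_function T phi & derive1 phi = h.
Proof.
move=> hs l0 rT h0 hI.
have hc := bump_span_continuous hs.
have hE : h \_ I = h.
  apply/funext => t; rewrite patch0E; case: ifPn => // tI.
  rewrite h0//; apply: contra tI; rewrite !in_itv/= => /andP[lt tr].
  by rewrite inE/= in_itv/= (lt_trans l0)//= (lt_trans tr).
have hi (D : set R) : measurable D -> mu.-integrable D (EFin \o h).
  by move=> mD; rewrite -hE; apply: sqint_patch => //; exact: sqint_contT.
pose phi x := \int[mu]_(t in `]-oo, x]) h t.
have phid x : derivable phi x 1 /\ derive1 phi x = h x.
  apply: (@continuous_FTC1 R h -oo%O x (x + 1)) => //.
  - by rewrite ltrDl.
  - by apply: hi; exact: measurable_itv.
  - by rewrite ltNyr.
  - exact: hc.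
have phi' : derive1 phi = h by apply/funext => x; exact: (phid x).2.
exists phi => //; split.
  case=> [|k] t; first by rewrite derive1n0; exact: (phid t).1.
  by rewrite derive1Sn phi'; exact: bump_span_smooth.
exists l, r; split => // t; rewrite in_itv/= negb_and -!ltNge => /orP[tl|rt].
  rewrite /phi (_ : 0 = \int[mu]_(t in `]-oo, t]) 0).
    apply: eq_Rintegral => s; rewrite inE/= in_itv/= => st.
    by rewrite h0// in_itv/= negb_and -leNgt (le_trans st (ltW tl)).
  by rewrite Rintegral_cst ?mul0r//; exact: measurable_itv.
rewrite -hI /phi Rintegral_mkcond [RHS]Rintegral_mkcond hE.
apply: eq_Rintegral => s _; rewrite patch0E; case: ifPn => //.
rewrite notin_setE/= in_itv/= => /negP; rewrite -ltNge => ts.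
by rewrite h0// in_itv/= negb_and -leNgt [s < r]ltNge (ltW (lt_trans rt ts)) orbT.
Qed.

(** exp (- 1 / ((m + 1) (t - a) (b - t))) on ]a, b[ and 0 elsewhere; it increases to
the indicator of ]a, b[ as m grows. *)
Definition bump (a b : R) (m : nat) (t : R) : R :=
  flat_exp 0 (m.+1%:R * ((t - a) * (b - t))).

Lemma bump_span_bump c a b m : bump_span (fun t => c * bump a b m t).
Proof.
have := bump_span_base c%:P (m.+1%:R *: (('X - a%:P) * (b%:P - 'X))) 0.
congr bump_span; apply/funext => t.
by rewrite hornerZ hornerM !(hornerD, hornerN, hornerX, hornerC).
Qed.

Lemma bump_out a b m t : a < b -> t \notin `]a, b[ -> bump a b m t = 0.
Proof.
move=> ab; rewrite in_itv/= negb_and -!leNgt /bump /flat_exp => tab.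
rewrite pmulr_rgt0// ltNge ifF//; apply/negbTE; rewrite negbK.
case/orP: tab => h.
  by rewrite mulr_le0_ge0// ?subr_le0// subr_ge0 (le_trans h)// ltW.
by rewrite mulr_ge0_le0// ?subr_le0// subr_ge0 (le_trans _ h)// ltW.
Qed.

Lemma bump_in a b m t : t \in `]a, b[ ->
  bump a b m t = expR (- (m.+1%:R * ((t - a) * (b - t)))^-1).
Proof.
rewrite in_itv/= => /andP[ta tb]; rewrite /bump /flat_exp ifT ?expr0 ?invr1 ?mul1r//.
by rewrite !mulr_gt0 ?subr_gt0.
Qed.

Lemma bump_ge0 a b m t : 0 <= bump a b m t.
Proof.
rewrite /bump /flat_exp; case: ifP => // _.
by rewrite expr0 invr1 mul1r expR_ge0.
Qed.

Lemma bump_le1 a b m t : bump a b m t <= 1.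
Proof.
rewrite /bump /flat_exp; case: ifPn => // h.
by rewrite expr0 invr1 mul1r expR_le1 oppr_le0 invr_ge0 ltW.
Qed.

Lemma bump_cvg a b t : a < b ->
  bump a b m t @[m --> \oo] --> ((t \in `]a, b[)%:R : R).
Proof.
move=> ab; case: (boolP (t \in `]a, b[)) => tab; last first.
  by apply: cvg_near_cst; apply: nearW => m; exact: bump_out.
have -> : bump a b ^~ t = (fun m => expR (- (m.+1%:R^-1 * ((t - a) * (b - t))^-1))).
  by apply/funext => m; rewrite bump_in// invfM.
rewrite [X in _ --> X](_ : _ = expR (- (0 * ((t - a) * (b - t))^-1))); last first.
  by rewrite mul0r oppr0 expR0.
apply: (continuous_cvg _ (@continuous_expR R _)).
apply: cvgN.
by apply: cvgM; [exact: cvg_harmonic|exact: cvg_cst].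
Qed.

End TestFunctions.

(** * The lemma of du Bois-Reymond *)

Section FundamentalLemma.
Context (R : realType) (T : R).
Hypothesis T_gt0 : 0 < T.
Local Notation mu := (@lebesgue_measure R).
Local Notation I := [set` `]0, T[].
Local Notation sqint := (sqint T).
Local Notation aeI := (aeI T).
Local Notation dotI := (dotI T).

Lemma sqint_bump a b m : sqint (bump a b m).
Proof.
apply: sqint_contT; have -> : bump a b m = fun t => 1 * bump a b m t.
  by apply/funext => s; rewrite mul1r.
exact: bump_span_continuous (bump_span_bump _ _ _ _).
Qed.

(** Dominated convergence, as the bumps tend boundedly to the indicator of ]a, b[. *)
Lemma bump_orthogonal_itv f a b : sqint f -> 0 < a -> a < b -> b < T ->
  (forall m, dotI f (bump a b m) = 0) -> \int[mu]_(t in `]a, b[) f t = 0.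
Proof.
move=> fs a0 ab bT f0.
have mf := sqint_meas fs.
have mind : measurable_fun (I : set (measurableTypeR R)) (fun t => (t \in `]a, b[)%:R : R).
  have mab : measurable (`]a, b[%classic : set (measurableTypeR R)).
    exact: measurable_itv.
  have := measurable_indic mab; move=> /(_ R I); apply: eq_measurable_fun => t _.
  by rewrite indicE mem_setE.
have [] := @dominated_convergence _ (measurableTypeR R) R mu I (measurable_I T)
  (fun m t => (f t * bump a b m t)%:E) (fun t => (f t * (t \in `]a, b[)%:R)%:E)
  (fun t => `|f t|%:E).
- move=> m; apply/measurable_EFinP; apply: measurable_funM => //.
  exact: sqint_meas (sqint_bump _ _ _).
- by apply/measurable_EFinP; apply: measurable_funM.
- apply: aeW => t It; apply: cvg_EFin.
    by apply: nearW.
  apply: cvgM; [exact: cvg_cst|exact: bump_cvg].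
- exact: sqint_integrable (sqint_norm fs).
- apply: aeW => t m It; rewrite /= lee_fin normrM ler_piMr//.
  by rewrite ger0_norm ?bump_ge0 ?bump_le1.
move=> _ _; rewrite (_ : (fun m => _) = cst 0%E); last first.
  apply/funext => m; transitivity (dotI f (bump a b m))%:E; last by rewrite f0.
  rewrite /dotI /Rintegral fineK//.
  apply: integrable_fin_num => //; exact: sqint_mul (sqint_bump _ _ _).
move=> h; have /= int0 := cvg_lim (@ereal_hausdorff R) h.
rewrite (cvg_lim (@ereal_hausdorff R) (cvg_cst 0%E)) in int0.
rewrite -[RHS]/(fine 0%E) int0.
rewrite Rintegral_mkcond; congr fine; rewrite [RHS]integral_mkcond.
apply: eq_integral => t _; rewrite !patchE !mem_setE.
case: ifPn => tab; last by case: ifP => // _; rewrite mulr0.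
rewrite ifT ?mulr1//; move: tab; rewrite !in_itv/= => /andP[ta tb].
by rewrite (lt_trans a0)//= (lt_trans tb).
Qed.

(** All integrals over subintervals vanish, so the primitive is locally constant; by
Lebesgue's differentiation theorem its derivative is f almost everywhere. *)
Lemma bump_orthogonal_eq0 f : sqint f ->
  (forall a b m, 0 < a -> a < b -> b < T -> dotI f (bump a b m) = 0) ->
  aeI f (fun=> 0).
Proof.
move=> fs f0.
pose g := f \_ I.
have gi (D : set R) : measurable D -> mu.-integrable D (EFin \o g).
  by move=> mD; exact: sqint_patch.
pose F x := \int[mu]_(t in `]-oo, x]) g t.
have Fcst x y : 0 < x -> x < y -> y < T -> F y = F x.
  move=> x0 xy yT; apply/eqP; rewrite -subr_eq0 /F.
  rewrite (@Rintegral_itvB R g -oo%O (BRight y) x)//.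
    rewrite -Rintegral_itv_bndo_bndc; last by apply: gi; exact: measurable_itv.
    rewrite -(bump_orthogonal_itv fs x0 xy yT); last by move=> m; exact: f0.
    apply/eqP; apply: eq_Rintegral => t; rewrite inE/= in_itv/= => /andP[xt ty].
    by rewrite /g patch0E ifT// inE/= in_itv/= (lt_trans x0)//= (lt_trans ty).
  - by apply: gi; exact: measurable_itv.
  - by rewrite bnd_simp ltW.
have loc : locally_integrable [set: R] g.
  by apply: open_integrable_locally; [exact: openT|exact: gi].
have := @FTC1Ny R g (fun y => gi _ (measurable_itv _)) loc.
apply: ae_mono => x [_ Fx] Ix.
have gx : g x = f x by rewrite /g patch0E mem_set.
rewrite -gx -Fx derive1E.
rewrite (@near_eq_derive _ _ _ _ (cst (F x))) ?derive_cst//.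
move: Ix; rewrite /= in_itv/= => /andP[x0 xT].
near=> y.
have y0 : 0 < y by near: y; exact: lt_nbhsr.
have yT : y < T by near: y; exact: lt_nbhsl.
by have [xy|xy|->//] := ltgtP x y; [exact: Fcst|exact/esym/Fcst].
Unshelve. all: by end_near. Qed.

Lemma test_derive1 phi : test_function T phi ->
  [/\ continuous phi, continuous (derive1 phi)
    & forall t : R, is_derive t (1 : R) phi (derive1 phi t)].
Proof.
move=> [phid _]; have d0 := phid 0; have d1 := phid 1.
rewrite derive1n0 in d0; rewrite derive1n1 in d1.
split=> t; [exact/differentiable_continuous/derivable1_diffP..|].
by rewrite derive1E; exact/derivableP.
Qed.

Lemma test_function_out phi t : test_function T phi -> t <= 0 \/ T <= t -> phi t = 0.
Proof.
move=> [_ [l [r [l0 rT out]]]] t0T; apply: out; rewrite in_itv/= negb_and -!ltNge.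
by case: t0T => h; [rewrite (le_lt_trans h)|rewrite (lt_le_trans rT) ?orbT].
Qed.

Lemma bump_test a b m : 0 < a -> a < b -> b < T -> test_function T (bump a b m).
Proof.
move=> a0 ab bT; split.
  move=> k t; have -> : bump a b m = fun t => 1 * bump a b m t.
    by apply/funext => s; rewrite mul1r.
  exact: bump_span_smooth (bump_span_bump _ _ _ _) _ _.
exists a, b; split => // t tab; apply: bump_out => //.
by apply: contra tab; exact: subset_itv_oo_cc.
Qed.

Lemma test_orthogonal_eq0 f : sqint f ->
  (forall phi, test_function T phi -> dotI f phi = 0) -> aeI f (fun=> 0).
Proof.
move=> fs f0; apply: bump_orthogonal_eq0 => // a b m a0 ab bT.
exact/f0/bump_test.
Qed.

(** Otherwise the constant 1 would be orthogonal to all these bumps, and ]a, b[ would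
have length 0. *)
Lemma bump_integral_neq0 a b : 0 < a -> a < b -> b < T ->
  exists m, dotI (fun=> 1) (bump a b m) != 0.
Proof.
move=> a0 ab bT; apply: contrapT => /forallNP b0.
have := @bump_orthogonal_itv (fun=> 1) a b (sqint_cst _ _) a0 ab bT.
have b1 m : dotI (fun=> 1) (bump a b m) = 0 by apply/eqP/negPn/negP/b0.
move=> /(_ b1).
rewrite Rintegral_cst ?mul1r; last exact: measurable_itv.
have e : fine (mu `]a, b[%classic) = b - a by rewrite lebesgue_measure_itv/= lte_fin ab.
by move=> /(etrans (esym e))/eqP; rewrite subr_eq0 gt_eqF.
Qed.

(** Fix a bump rho of nonzero integral.  Every bump psi differs from a multiple of rho by
a function of integral 0, which is the derivative of a test function; so f minus
the constant given by rho is orthogonal to all bumps. *)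
Lemma test_derive_orthogonal_cst f : sqint f ->
  (forall phi, test_function T phi -> dotI f (derive1 phi) = 0) ->
  exists c, aeI f (fun=> c).
Proof.
move=> fs f0.
(* any subinterval with closure inside the interval would do for rho *)
pose a0 := T / 3; pose b0 := 2 * T / 3.
have a0_gt0 : 0 < a0 by rewrite divr_gt0.
have ab0 : a0 < b0 by rewrite ltr_pM2r ?invr_gt0//; have := T_gt0; lra.
have b0T : b0 < T by rewrite ltr_pdivrMr//; have := T_gt0; lra.
have [m0 rho_neq0] := bump_integral_neq0 a0_gt0 ab0 b0T.
pose rho := bump a0 b0 m0.
pose J g := dotI (fun=> 1) g.
pose k := dotI f rho / J rho.
have cs := sqint_cst T 1 : sqint (fun=> 1).
exists k; suff h : aeI (fun t => - k * 1 + f t) (fun=> 0).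
  apply: ae_mono h => t + It => /(_ It) h.
  by apply/eqP; rewrite -subr_eq0 addrC -[k]mulr1 -mulNr h.
apply: bump_orthogonal_eq0; first exact: sqint_lin.
move=> a b m a_gt0 ab bT; pose psi := bump a b m.
have psis : sqint psi := sqint_bump a b m.
have rhos : sqint rho := sqint_bump a0 b0 m0.
pose h t := - (J psi / J rho) * rho t + psi t.
have Jh : J h = 0.
  rewrite /J dotIC dotI_lin//.
  rewrite (dotIC _ psi) (dotIC _ rho).
  by rewrite -/(J rho) -/(J psi) mulNr divfK ?addNr.
have [|||||phi phit phi'] := @bump_span_primitive_test R T h (Num.min a a0) (Num.max b b0).
- apply: bump_span_add; first exact: bump_span_bump.
  by have := bump_span_bump 1 a b m; congr bump_span; apply/funext => t; rewrite mul1r.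
- by rewrite lt_min a_gt0.
- by rewrite gt_max bT.
- move=> t; rewrite in_itv/= gt_min lt_max => tn.
  rewrite /h /rho /psi !bump_out ?mulr0 ?addr0//; rewrite in_itv/=; apply: contra tn.
    by case/andP => -> ->; rewrite ?orbT.
  by case/andP => -> ->; rewrite ?orbT.
- by rewrite -[RHS]Jh; apply: eq_Rintegral => t _; rewrite mul1r.
have := f0 _ phit; rewrite phi' dotIC dotI_lin// (dotIC _ rho) (dotIC _ psi) => fh.
have -> : dotI (fun t => - k * 1 + f t) psi = - k * J psi + dotI f psi by exact: dotI_lin.
rewrite -[RHS]fh /k.
move: (dotI f rho) (J psi) (dotI f psi) (J rho) => u v w x.
by rewrite !mulNr mulrAC [in RHS]mulrAC (mulrC v).
Qed.

End FundamentalLemma.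

(** * Volterra operators on L2 *)

Section VolterraOperators.
Context (R : realType) (T : R).
Hypothesis T_gt0 : 0 < T.
Local Notation mu := (@lebesgue_measure R).
Local Notation I := [set` `]0, T[].
Local Notation sqint := (sqint T).
Local Notation aeI := (aeI T).
Local Notation dotI := (dotI T).
Local Notation primitive0 := (primitive0 T).
Local Notation primitiveT := (primitiveT T).

Lemma primitive0_FTC (x dx : R -> R) (t : R) :
  {within `[0, T], continuous x} -> {within `[0, T], continuous dx} ->
  (forall s : R, s \in `]0, T[ -> is_derive s (1 : R) x (dx s)) ->
  0 < t -> t <= T -> primitive0 dx t = x t - x 0.
Proof.
move=> cx cdx xdx t0 tT.
have sub : `[0, t]%classic `<=` `[0, T]%classic by apply: subset_itvl; rewrite bnd_simp.
have cxt := continuous_subspaceW sub cx.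
have cdxt := continuous_subspaceW sub cdx.
have inT s : s \in `]0, t[ -> s \in `]0, T[.
  by rewrite !in_itv/= => /andP[-> st]; exact: lt_le_trans tT.
have [_ x0 xt] := (continuous_within_itvP _ t0).1 cxt.
have lr : derivable_oo_LRcontinuous x 0 t.
  by split => // s /inT/xdx[].
have x'E : {in `]0, t[, derive1 x =1 dx}.
  by move=> s /inT/xdx[? <-]; rewrite derive1E.
have := continuous_FTC2 t0 cdxt lr x'E.
move=> /(congr1 fine)/= <-; rewrite -/(Rintegral mu _ _).
have dxi : mu.-integrable `[0, t] (EFin \o dx).
  by apply: continuous_compact_integrable => //; exact: segment_compact.
have sub2 (D : set R) : measurable D -> D `<=` `[0, t]%classic -> mu.-integrable D (EFin \o dx).
  by move=> mD DS; apply: integrableS dxi => //; exact: measurable_itv.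
have dxs := sqint_continuous cdx.
rewrite /primitive0 -Rintegral_itv_bndo_bndc; last first.
  by apply: sqint_patch => //; exact: measurable_itv.
rewrite -Rintegral_itv_obnd_cbnd; last by apply: sqint_patch => //; exact: measurable_itv.
rewrite -[RHS]Rintegral_itv_bndo_bndc; last first.
  by apply: sub2; [exact: measurable_itv|apply: subset_itvl; rewrite bnd_simp].
rewrite -[RHS]Rintegral_itv_obnd_cbnd; last first.
  by apply: sub2; [exact: measurable_itv|exact: subset_itv_oo_cc].
apply: eq_Rintegral => s; rewrite inE => /= /inT sT.
by rewrite patch0E mem_set.
Qed.

Lemma primitive0_T f : sqint f -> primitive0 f T = \int[mu]_(t in I) f t.
Proof.
move=> fs; rewrite /primitive0.
rewrite -Rintegral_itv_bndo_bndc; last by apply: sqint_patch => //; exact: measurable_itv.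
rewrite -Rintegral_itv_obnd_cbnd; last by apply: sqint_patch => //; exact: measurable_itv.
by apply: eq_Rintegral => s sI; rewrite patch0E sI.
Qed.

Lemma primitiveT_lin a f g t : sqint f -> sqint g ->
  primitiveT (fun x => a * f x + g x) t = a * primitiveT f t + primitiveT g t.
Proof.
move=> fs gs; rewrite /primitiveT -!primitive0_T// ?primitive0_lin//; last exact: sqint_lin.
ring.
Qed.

Lemma primitiveT_ae f g t : sqint f -> sqint g -> aeI f g -> primitiveT f t = primitiveT g t.
Proof. by move=> fs gs fg; rewrite /primitiveT -!primitive0_T// !(primitive0_ae _ fs gs fg). Qed.

Lemma primitiveT_continuous f : sqint f -> {within `[0, T], continuous (primitiveT f)}.
Proof.
move=> fs x; apply: cvgB; first exact: cvg_cst.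
exact: primitive0_continuous.
Qed.

Lemma sqint_primitiveT f : sqint f -> sqint (primitiveT f).
Proof. by move=> fs; apply: sqint_continuous; exact: primitiveT_continuous. Qed.

Lemma primitiveT_le f t : sqint f -> `|primitiveT f t| <= primitiveT (fun x => `|f x|) t.
Proof.
move=> fs; have ns := sqint_norm fs; rewrite !primitiveT_ltE//.
have iF (g : R -> R) : sqint g ->
    mu.-integrable setT (EFin \o (fun s => if t < s then (g \_ I) s else 0)).
  move=> gs; have gi : mu.-integrable setT (EFin \o (g \_ I)) by exact: sqint_patch.
  apply: (le_integrable _ _ _ gi) => //.
    apply/measurable_EFinP; apply: measurable_fun_ifT => //.
      exact: measurable_fun_ltr.
    by case/integrableP : gi => /measurable_EFinP.
  by move=> s _ /=; case: ifP => _; rewrite lee_fin ?normr0.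
apply: (le_trans (le_normr_Rintegral _ _)) => //; first exact: iF.
rewrite le_eqVlt; apply/orP; left; apply/eqP; apply: eq_Rintegral => s _.
rewrite !patch0E; case: ifP => _; rewrite ?normr0//.
by case: ifP; rewrite ?normr0.
Qed.

Section Uniqueness.
Variable S : (R -> R) -> R -> R.
Hypothesis S_sqint : forall f, sqint f -> sqint (S f).
Hypothesis S_le : forall f t, sqint f -> `|S f t| <= S (fun x => `|f x|) t.
Hypothesis S_weight : forall c, 0 < c -> exists w, [/\ sqint w, forall t, 0 < w t &
  forall a, sqint a -> (forall t, 0 <= a t) -> dotI w (S a) <= c^-1 * dotI w a].

Let sumI n (C : 'M[R]_n) : 0 <= \sum_i \sum_j `|C i j|.
Proof. by apply: sumr_ge0 => i _; apply: sumr_ge0. Qed.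

(** A Gronwall argument in integrated form.  With a weight w whose integral against S a
is at most (2 K)^-1 times that against a, where K exceeds the sum of the |C i j|, the sum
of the weighted L1 norms of the components of z is at most half of itself.  Both
Volterra integrals are instances, with exponential weights of opposite signs. *)
Lemma volterra_unique n (C : 'M[R]_n) (z : {ffun 'I_n -> L2 T}) :
  z = mact C (lift_op (fun u => L2of T (S (L2fun u))) z) -> z = 0.
Proof.
move=> zE.
pose K := \sum_i \sum_j `|C i j| + 1.
have K0 : 0 < K by rewrite ltr_wpDl ?sumI.
have [w [ws w0 wS]] : exists w, [/\ sqint w, forall t, 0 < w t &
  forall a, sqint a -> (forall t, 0 <= a t) -> dotI w (S a) <= (2 * K)^-1 * dotI w a].
  by apply: S_weight; rewrite mulr_gt0.
pose zf i := L2fun (z i); pose az i x := `|zf i x|.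
have zs i : sqint (zf i) by exact: sqint_L2.
have azs i : sqint (az i) by exact: sqint_norm.
have Ss i : sqint (S (zf i)) by exact: S_sqint.
have Sas i : sqint (S (az i)) by exact: S_sqint.
have zfE i : aeI (zf i) (fun x => \sum_j C i j * S (zf j) x).
  rewrite /zf {1}zE ffunE; under eq_bigr do rewrite ffunE.
  apply: aeI_trans (L2fun_sum _ _ _) _; apply: aeI_sum => j.
  by apply: ae_mono (L2ofE (Ss j)) => x h Ix; rewrite h.
pose al i := dotI w (az i).
have al_ge0 i : 0 <= al i.
  by apply: Rintegral_ge0 => x _; apply: mulr_ge0; [exact/ltW|exact: normr_ge0].
have al_le i : al i <= \sum_j `|C i j| * ((2 * K)^-1 * al j).
  have CSs : sqint (fun x => \sum_j C i j * S (zf j) x).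
    by apply: sqint_sum => j; exact: sqintZ.
  have -> : al i = dotI w (fun x => `|\sum_j C i j * S (zf j) x|).
    apply: dotI_ae => //; first exact: sqint_norm.
    by apply: ae_mono (zfE i) => x h Ix; rewrite /az h.
  apply: (@le_trans _ _ (dotI (fun x => \sum_j `|C i j| * S (az j) x) w)).
    rewrite dotIC; apply: le_Rintegral => //.
    - by apply: sqint_mul => //; exact: sqint_norm.
    - by apply: sqint_mul => //; apply: sqint_sum => j; exact: sqintZ.
    move=> x _; rewrite ler_wpM2r ?(ltW (w0 _))// (le_trans (ler_norm_sum _ _ _))//.
    by apply: ler_sum => j _; rewrite normrM ler_wpM2l// S_le.
  have -> : dotI (fun x => \sum_j `|C i j| * S (az j) x) w =
      \sum_j `|C i j| * dotI w (S (az j)).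
    elim: (index_enum _) => [|j s ih].
      rewrite big_nil /dotI -[RHS](mul0r (fine (mu I))) -Rintegral_cst//.
      by apply: eq_Rintegral => x _; rewrite big_nil mul0r.
    rewrite big_cons -ih (dotIC _ w) -dotI_lin//; last first.
      by apply: sqint_sum => k; exact: sqintZ.
    by apply: eq_Rintegral => x _; rewrite big_cons.
  apply: ler_sum => j _; apply: ler_wpM2l => //; apply: wS => // t.
  exact: normr_ge0.
have sum_le : \sum_i al i <= 2^-1 * \sum_i al i.
  apply: (@le_trans _ _ (\sum_i \sum_j `|C i j| * ((2 * K)^-1 * al j))).
    by apply: ler_sum => i _.
  rewrite exchange_big/= mulr_sumr; apply: ler_sum => j _.
  rewrite -mulr_suml mulrA ler_wpM2r// ler_pdivrMr ?mulr_gt0//.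
  rewrite mulrA mulVf ?pnatr_eq0// mul1r.
  apply: (@le_trans _ _ (\sum_i \sum_k `|C i k|)); last by rewrite lerDl.
  by apply: ler_sum => i _; rewrite [leRHS](bigD1 j)//= lerDl; exact: sumr_ge0.
have sum0 : \sum_i al i = 0.
  by apply/eqP; rewrite eq_le sumr_ge0 ?andbT//; lra.
apply/ffunP => i; rewrite ffunE; apply: L2_eq; apply: aeI_trans (aeI_sym (L2fun0 T)).
have : al i = 0.
  apply/eqP; rewrite eq_le al_ge0 andbT -sum0 (bigD1 i)//= lerDl.
  by apply: sumr_ge0 => j _.
move=> /(Rintegral_eq0_ae (sqint_mul ws (azs i))) h.
apply: ae_mono (h _) => [x + Ix|x _]; last first.
  by apply: mulr_ge0; [exact/ltW|exact: normr_ge0].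
by move=> /(_ Ix)/eqP; rewrite mulf_eq0 gt_eqF//= normr_eq0 => /eqP.
Qed.

End Uniqueness.

Lemma continuous_expM (k : R) : continuous (fun t : R => expR (k * t)).
Proof.
move=> t; apply: (continuous_cvg _ (@continuous_expR R _)).
by apply: cvgM; [exact: cvg_cst|exact: cvg_id].
Qed.

Lemma sqint_expM (k : R) : sqint (fun t : R => expR (k * t)).
Proof. by apply: sqint_contT; exact: continuous_expM. Qed.

Lemma primitive0_expM (k t : R) : k != 0 -> 0 < t -> t <= T ->
  primitive0 (fun s => expR (k * s)) t = k^-1 * (expR (k * t) - 1).
Proof.
move=> k0 t0 tT.
have d s : is_derive s (1 : R) (fun t : R => k^-1 * expR (k * t)) (expR (k * s)).
  have dk : is_derive s (1 : R) (fun t : R => k * t) k.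
    have := is_deriveZ k (is_derive_id s (1 : R)).
    by rewrite /GRing.scale/= mulr1.
  have := is_deriveZ k^-1 (@is_derive1_comp R expR (fun t => k * t) s _ _ (is_derive_expR _) dk).
  by rewrite /GRing.scale/= mulrCA mulVf// mulr1.
have ck s : continuous_at s (fun t : R => k^-1 * expR (k * t)).
  by apply: cvgM; [exact: cvg_cst|exact: continuous_expM].
rewrite (@primitive0_FTC (fun t => k^-1 * expR (k * t)))//.
- by rewrite mulr0 expR0 mulrBr.
- exact: continuous_subspaceT.
- by apply: continuous_subspaceT; exact: continuous_expM.
Qed.

Lemma dotI_le f g w : sqint f -> sqint g -> sqint w -> (forall t, I t -> 0 <= w t) ->
  (forall t, I t -> f t <= g t) -> dotI f w <= dotI g w.
Proof.
move=> fs gs ws w0 fg; apply: le_Rintegral => //; [exact: sqint_mul..|].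
by move=> t It; apply: ler_wpM2r; [exact: w0|exact: fg].
Qed.

Lemma dotIZ c f g : sqint f -> sqint g -> dotI (fun x => c * f x) g = c * dotI f g.
Proof.
move=> fs gs; rewrite /dotI -RintegralZl//; last exact: sqint_mul.
by apply: eq_Rintegral => x _; rewrite mulrA.
Qed.

(** The weight exp (- c t): its integral from t to T is at most itself divided by c. *)
Lemma primitive0_weight c : 0 < c -> exists w, [/\ sqint w, forall t, 0 < w t &
  forall a, sqint a -> (forall t, 0 <= a t) -> dotI w (primitive0 a) <= c^-1 * dotI w a].
Proof.
move=> c0; pose w t := expR (- c * t).
have ws : sqint w by exact: sqint_expM.
have cN0 : - c != 0 by rewrite oppr_eq0 gt_eqF.
exists w; split => // [t|a as_ a0]; first exact: expR_gt0.
rewrite dotIC primitive0_adjoint// dotIC -dotIZ//; apply: dotI_le => //.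
- exact: sqint_primitiveT.
- exact: sqintZ.
move=> t; rewrite /= in_itv/= => /andP[t0 tT].
rewrite /primitiveT -primitive0_T// !primitive0_expM// ?(ltW tT)// invrN -mulrBr mulNr -mulrN.
rewrite ler_wpM2l ?invr_ge0 ?(ltW c0)//.
by have := expR_ge0 (- c * T); rewrite /w; lra.
Qed.

(** The weight exp (c t): its integral from 0 to t is at most itself divided by c. *)
Lemma primitiveT_weight c : 0 < c -> exists w, [/\ sqint w, forall t, 0 < w t &
  forall a, sqint a -> (forall t, 0 <= a t) -> dotI w (primitiveT a) <= c^-1 * dotI w a].
Proof.
move=> c0; pose w t := expR (c * t).
have ws : sqint w by exact: sqint_expM.
exists w; split => // [t|a as_ a0]; first exact: expR_gt0.
rewrite -primitive0_adjoint// -dotIZ//; apply: dotI_le => //.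
- exact: sqint_primitive0.
- exact: sqintZ.
move=> t; rewrite /= in_itv/= => /andP[t0 tT].
rewrite primitive0_expM ?(ltW tT) ?gt_eqF// ler_wpM2l ?invr_ge0 ?(ltW c0)//.
by rewrite lerBlDr lerDl.
Qed.

Definition volterra0 (u : L2 T) : L2 T := L2of T (primitive0 (L2fun u)).
Definition volterraT (u : L2 T) : L2 T := L2of T (primitiveT (L2fun u)).

Lemma volterra0_is_linear a u v : volterra0 (a *: u + v) = a *: volterra0 u + volterra0 v.
Proof.
rewrite /volterra0 -L2of_lin; [|exact: sqint_primitive0..]; congr L2of; apply/funext => t.
rewrite -primitive0_lin//; apply: primitive0_ae; [by []|exact: sqint_lin|exact: L2fun_lin].
Qed.

Lemma volterraT_is_linear a u v : volterraT (a *: u + v) = a *: volterraT u + volterraT v.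
Proof.
rewrite /volterraT -L2of_lin; [|exact: sqint_primitiveT..]; congr L2of; apply/funext => t.
rewrite -primitiveT_lin//; apply: primitiveT_ae; [by []|exact: sqint_lin|exact: L2fun_lin].
Qed.

Lemma volterra0_adjoint u v : ip (volterra0 u) v = ip u (volterraT v).
Proof.
have us := sqint_L2 u; have vs := sqint_L2 v.
transitivity (dotI (primitive0 (L2fun u)) (L2fun v)).
  rewrite ipC ip_L2ofr; [exact: dotIC|exact: sqint_primitive0].
rewrite (primitive0_adjoint us vs) ip_L2ofr//; exact: sqint_primitiveT.
Qed.

Lemma primitive0_test phi t : test_function T phi -> 0 < t -> t <= T ->
  primitive0 (derive1 phi) t = phi t.
Proof.
move=> phit t0 tT; have [c0 c1 d] := test_derive1 phit.
rewrite (@primitive0_FTC phi)//; [|exact: continuous_subspaceT..].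
by rewrite (test_function_out phit (or_introl (lexx 0))) subr0.
Qed.

Lemma primitiveT_test phi t : test_function T phi -> 0 < t -> t <= T ->
  primitiveT (derive1 phi) t = - phi t.
Proof.
move=> phit t0 tT; have [c0 c1 d] := test_derive1 phit.
rewrite /primitiveT -primitive0_T ?primitive0_test//; last exact: sqint_contT.
by rewrite (test_function_out phit (or_intror (lexx T))) sub0r.
Qed.

Lemma sqint_test phi : test_function T phi -> sqint phi /\ sqint (derive1 phi).
Proof. by move=> /test_derive1[c0 c1 _]; split; exact: sqint_contT. Qed.

Lemma dotI_eqr f g h : (forall t, I t -> g t = h t) -> dotI f g = dotI f h.
Proof. by move=> gh; apply: eq_Rintegral => t; rewrite inE => It; rewrite gh. Qed.

Lemma volterra0_test f phi : sqint f -> test_function T phi ->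
  dotI (primitive0 f) (derive1 phi) = - dotI f phi.
Proof.
move=> fs phit; have [s0 s1] := sqint_test phit.
rewrite primitive0_adjoint// -mulN1r (dotIC _ f phi) -dotIZ// (dotIC _ _ f).
apply: dotI_eqr => t; rewrite /= in_itv/= => /andP[t0 tT].
by rewrite primitiveT_test ?(ltW tT)// mulN1r.
Qed.

Lemma volterraT_test f phi : sqint f -> test_function T phi ->
  dotI (primitiveT f) (derive1 phi) = dotI f phi.
Proof.
move=> fs phit; have [s0 s1] := sqint_test phit.
rewrite dotIC -primitive0_adjoint// dotIC.
apply: dotI_eqr => t; rewrite /= in_itv/= => /andP[t0 tT].
by rewrite primitive0_test ?(ltW tT).
Qed.

Lemma dotI_zero_ae f g : sqint f -> sqint g -> aeI f (fun=> 0) -> dotI f g = 0.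
Proof.
move=> fs gs f0; rewrite (dotI_ae fs gs (sqint_cst T 0) gs f0 (aeI_refl _ _)).
rewrite /dotI -[RHS](mul0r (fine (mu I))) -Rintegral_cst//.
by apply: eq_Rintegral => x _; rewrite mul0r.
Qed.

(** By adjunction: test functions are primitives of their derivatives, so u is
orthogonal to all test functions. *)
Lemma volterra0_inj u : volterra0 u = 0 -> u = 0.
Proof.
move=> Vu; have us := sqint_L2 u.
have V0 : aeI (primitive0 (L2fun u)) (fun=> 0).
  apply: aeI_trans (aeI_sym (L2ofE (sqint_primitive0 T_gt0 us))) _.
  by rewrite -/(volterra0 u) Vu; exact: L2fun0.
apply: L2_eq; apply: aeI_trans (aeI_sym (L2fun0 T)).
apply: test_orthogonal_eq0 => // phi phit; have [s0 s1] := sqint_test phit.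
by rewrite -[LHS]opprK -volterra0_test// dotI_zero_ae ?oppr0//; exact: sqint_primitive0.
Qed.

Lemma volterraT_inj u : volterraT u = 0 -> u = 0.
Proof.
move=> Vu; have us := sqint_L2 u.
have V0 : aeI (primitiveT (L2fun u)) (fun=> 0).
  apply: aeI_trans (aeI_sym (L2ofE (sqint_primitiveT us))) _.
  by rewrite -/(volterraT u) Vu; exact: L2fun0.
apply: L2_eq; apply: aeI_trans (aeI_sym (L2fun0 T)).
apply: test_orthogonal_eq0 => // phi phit; have [s0 s1] := sqint_test phit.
by rewrite -volterraT_test// dotI_zero_ae//; exact: sqint_primitiveT.
Qed.

Lemma volterra0_pencil_unique n (E A : 'M[R]_n) (x : {ffun 'I_n -> L2 T}) l :
  \det (l *: E - A) != 0 -> mact E x = mact A (lift_op volterra0 x) -> x = 0.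
Proof.
move=> det0.
apply: (@pencil_volterra_unique R (L2 T) volterra0 volterra0_is_linear volterra0_inj
  _ _ E A x l det0).
move=> m C z; apply: (@volterra_unique primitive0).
- by move=> f; exact: sqint_primitive0.
- by move=> f t; exact: primitive0_le.
- exact: primitive0_weight.
Qed.

Lemma volterraT_pencil_unique n (E A : 'M[R]_n) (x : {ffun 'I_n -> L2 T}) l :
  \det (l *: E - A) != 0 -> mact E x = mact A (lift_op volterraT x) -> x = 0.
Proof.
move=> det0.
apply: (@pencil_volterra_unique R (L2 T) volterraT volterraT_is_linear volterraT_inj
  _ _ E A x l det0).
move=> m C z; apply: (@volterra_unique primitiveT).
- by move=> f; exact: sqint_primitiveT.
- by move=> f t; exact: primitiveT_le.
- exact: primitiveT_weight.
Qed.

End VolterraOperators.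

(** * Completeness of L2 *)

Section Completeness.
Context (R : realType) (T : R).
Local Notation mu := (@lebesgue_measure R).
Local Notation I := [set` `]0, T[].
Local Notation sqint := (sqint T).
Local Notation aeI := (aeI T).
Local Notation dotI := (dotI T).

Lemma geometric_half_le (n : nat) : \sum_(i < n) 2^-1 ^+ i <= 2 :> R.
Proof.
suff -> : \sum_(i < n) 2^-1 ^+ i = 2 - 2 * 2^-1 ^+ n :> R.
  by rewrite gerBl mulr_ge0// exprn_ge0.
elim: n => [|n ih]; first by rewrite big_ord0 expr0 mulr1 subrr.
by rewrite big_ord_recr/= ih exprS; field.
Qed.

Lemma limn_einf_le (u : nat -> \bar R) (c : \bar R) (k : nat) :
  (forall n, (k <= n)%N -> (u n <= c)%E) -> (limn_einf u <= c)%E.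
Proof.
move=> uc; rewrite limn_einf_lim; apply: lime_le; first exact: is_cvg_einfs.
near=> n; apply: (@le_trans _ _ (u n)).
  by apply: ereal_inf_lbound; exists n => //=.
by apply: uc; near: n; exact: nbhs_infty_ge.
Unshelve. all: by end_near. Qed.

Lemma abs_summable_cvg (u : nat -> R) :
  (\sum_(n <oo) `|u n.+1 - u n|%:E < +oo)%E -> cvgn u.
Proof.
move=> s; have s0 : (0 <= \sum_(n <oo) `|u n.+1 - u n|%:E)%E by apply: nneseries_ge0.
have sfin : (\sum_(n <oo) `|u n.+1 - u n|%:E)%E \is a fin_num by rewrite ge0_fin_numE.
have cv : cvgn (series (telescope u)).
  apply: (@normed_cvg _ R^o); apply: nondecreasing_is_cvgn.
    by apply: nondecreasing_series => n _ _; exact: normr_ge0.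
  exists (fine (\sum_(n <oo) `|u n.+1 - u n|%:E)%E) => _ [n _ <-].
  rewrite -lee_fin fineK//.
  have := @nneseries_lim_ge R (fun n => `|u n.+1 - u n|%:E) xpredT 0 n.
  rewrite /series/= sumEFin; apply => k _ _.
  by rewrite lee_fin.
have -> : u = (fun n => u 0%N + series (telescope u) n).
  by apply/funext => n; exact: eq_sum_telescope.
by apply: is_cvgD => //; exact: is_cvg_cst.
Qed.

Let ipDL := @ipL R T.
Local Notation nrmI := (nrm (@ip R T)).

Lemma nrm_L2_dotI f u : sqint f -> aeI (L2fun u) f -> nrmI u ^+ 2 = dotI f f.
Proof.
by move=> fs uf; rewrite (nrm_sqr (@ip_ge0 R T)); exact: dotI_ae.
Qed.

Lemma L1_norm_le (u : L2 T) : \int[mu]_(t in I) `|L2fun u t| <= nrmI (L2of T (fun=> 1)) * nrmI u.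
Proof.
have us := sqint_L2 u; have ns := sqint_norm us.
have -> : \int[mu]_(t in I) `|L2fun u t| = ip (L2of T (fun=> 1)) (L2of T (fun t => `|L2fun u t|)).
  rewrite ip_L2of//; last exact: sqint_cst.
  by apply: eq_Rintegral => t _; rewrite mul1r.
have -> : nrmI u = nrmI (L2of T (fun t => `|L2fun u t|)).
  congr Num.sqrt; rewrite ip_L2of//; apply: eq_Rintegral => t _.
  by rewrite -normrM ger0_norm// -expr2 sqr_ge0.
by apply: (le_trans (ler_norm _)); exact: dot_le_nrm (@ipL R T) (@ipC R T) (@ip_ge0 R T) _ _.
Qed.

Lemma geometric_cauchy (g : nat -> L2 T) (k m : nat) :
  (forall k, nrmI (g k.+1 - g k) <= 2^-1 ^+ k) -> (k <= m)%N ->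
  nrmI (g k - g m) <= 2 * 2^-1 ^+ k.
Proof.
move=> gc /subnKC <-.
have nrmN u v : nrmI (u - v) = nrmI (v - u).
  by rewrite -opprB /nrm (dotNl ipDL) (ipC (v - u)) (dotNl ipDL) opprK.
rewrite nrmN.
apply: (@le_trans _ _ (2^-1 ^+ k * \sum_(i < m - k) 2^-1 ^+ i)); last first.
  by rewrite mulrC ler_wpM2r ?exprn_ge0// geometric_half_le.
elim: (m - k)%N => [|n ih].
  by rewrite addn0 subrr big_ord0 mulr0 /nrm (dot0l ipDL) sqrtr0.
rewrite big_ord_recr/= mulrDr -exprD addnS.
have -> : g (k + n).+1 - g k = (g (k + n)%N - g k) + (g (k + n).+1 - g (k + n)%N).
  by rewrite [RHS]addrC addrA subrK.
apply: (le_trans (nrm_triangle ipDL (@ipC _ _) (@ip_ge0 _ _) _ _)).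
by rewrite lerD.
Qed.

(** The proof of Riesz and Fischer: the increments are summable in L1, so the sequence
converges almost everywhere, and Fatou's lemma bounds the distance to the limit. *)
Lemma L2_complete (g : nat -> L2 T) :
  (forall k, nrmI (g k.+1 - g k) <= 2^-1 ^+ k) ->
  exists x, forall k, nrmI (g k - x) <= 2 * 2^-1 ^+ k.
Proof.
move=> gc.
pose f k := L2fun (g k); pose d k := L2fun (g k.+1 - g k).
have fs k : sqint (f k) by exact: sqint_L2.
have ds k : sqint (d k) by exact: sqint_L2.
have mf k : measurable_fun (I : set (measurableTypeR R)) (f k) by exact: sqint_meas.
have md k : measurable_fun (I : set (measurableTypeR R)) (fun t => `|d k t|%:E).
  by apply/measurable_EFinP; apply: measurableT_comp => //; exact: sqint_meas.
have dE : \forall t \ae mu, forall k, I t -> d k t = f k.+1 t - f k t.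
  by apply: ae_foralln => k; exact: L2funB.
have sum_fin : \forall t \ae mu, I t -> (\sum_(k <oo) `|d k t|%:E)%E \is a fin_num.
  apply: integrable_ae => //; apply/integrableP; split.
    by apply: ge0_emeasurable_sum => // k _ _; exact: md.
  have -> : (\int[mu]_(t in I) `|\sum_(k <oo) `|d k t|%:E| =
      \int[mu]_(t in I) \sum_(k <oo) `|d k t|%:E)%E.
    by apply: eq_integral => t _; rewrite gee0_abs// nneseries_ge0.
  rewrite integral_nneseries//.
  pose S := nrmI (L2of T (fun=> 1)).
  apply: (@le_lt_trans _ _ (S * 2)%:E); last by rewrite ltry.
  apply: lime_le; first by apply: is_cvg_nneseries => k _ _; exact: integral_ge0.
  apply: nearW => n; rewrite big_mkord.
  apply: (@le_trans _ _ (\sum_(i < n) (S * 2^-1 ^+ i)%:E)%E).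
    apply: lee_sum => i _.
    have di := sqint_integrable (sqint_norm (ds i)).
    rewrite -[X in (X <= _)%E]fineK; last exact: integrable_fin_num.
    rewrite lee_fin; apply: le_trans (L1_norm_le _) _.
    by rewrite ler_wpM2l// nrm_ge0.
  rewrite sumEFin lee_fin -mulr_sumr ler_wpM2l ?nrm_ge0//.
  exact: geometric_half_le.
have fcvg : \forall t \ae mu, I t -> cvgn (f ^~ t).
  apply: ae_mono2 dE sum_fin => t dt st It; apply: abs_summable_cvg.
  have := st It; rewrite ge0_fin_numE ?nneseries_ge0//.
  by congr (_ < _)%E; apply: eq_eseriesr => k _; rewrite dt.
(* an everywhere defined measurable candidate for the limit *)
pose h t := fine (limn_esup (fun k => (f k t)%:E)).
have mh : measurable_fun (I : set (measurableTypeR R)) h.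
  apply: measurableT_comp => //; apply: measurable_fun_limn_esup => k.
  exact/measurable_EFinP.
have fh : \forall t \ae mu, I t -> f ^~ t @ \oo --> h t.
  apply: ae_mono fcvg => t ft It; have /cvg_ex[l fl] := ft It.
  rewrite /h; have /cvg_limn_einf_sup[_ ->] : (f k t)%:E @[k --> \oo] --> l%:E.
    by apply: cvg_EFin => //; exact: nearW.
  exact: fl.
have fatou_bound k : (\int[mu]_(t in I) ((f k t - h t) ^+ 2)%:E <= ((2 * 2^-1 ^+ k) ^+ 2)%:E)%E.
  have m2 j : measurable_fun (I : set (measurableTypeR R)) (fun t => ((f k t - f j t) ^+ 2)%:E).
    by apply/measurable_EFinP; apply: measurable_funX; exact: measurable_funB.
  have -> : (\int[mu]_(t in I) ((f k t - h t) ^+ 2)%:E =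
      \int[mu]_(t in I) limn_einf (fun j => ((f k t - f j t) ^+ 2)%:E))%E.
    apply: ge0_ae_eq_integral => //.
    - by apply/measurable_EFinP; apply: measurable_funX; exact: measurable_funB.
    - apply: measurableT_comp => //; apply: measurable_fun_limn_esup => j.
      exact: measurableT_comp.
    - by move=> t _; rewrite lee_fin sqr_ge0.
    - move=> t _; rewrite limn_einf_lim; apply: lime_ge; first exact: is_cvg_einfs.
      by apply: nearW => j; apply: le_ereal_inf_tmp => _ [i _ <-]; rewrite lee_fin sqr_ge0.
    apply: ae_mono fh => t ft It.
    have /cvg_limn_einf_sup[-> _] :
        ((f k t - f j t) ^+ 2)%:E @[j --> \oo] --> ((f k t - h t) ^+ 2)%:E.
      apply: cvg_EFin; first exact: nearW.
      under eq_fun do rewrite expr2; rewrite expr2.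
      by apply: cvgM; apply: cvgB; [exact: cvg_cst|exact: ft|exact: cvg_cst|exact: ft].
    by [].
  apply: le_trans (fatou _ _ m2 _) _ => //; first by move=> j t _; rewrite lee_fin sqr_ge0.
  apply: (@limn_einf_le _ _ k) => j kj.
  have kjs : sqint (fun t => f k t - f j t).
    have := sqint_lin (-1) (fs j) (fs k).
    by congr sqint; apply/funext => t; rewrite mulN1r addrC.
  have /sqintP[_ kji] := kjs.
  rewrite -[X in (X <= _)%E]fineK; last exact: integrable_fin_num.
  rewrite lee_fin (_ : fine _ = nrmI (g k - g j) ^+ 2); last first.
    rewrite (nrm_L2_dotI kjs); last exact: L2funB.
    by apply: eq_Rintegral => t _; rewrite expr2.
  by rewrite lerXn2r ?nnegrE ?nrm_ge0 ?mulr_ge0 ?exprn_ge0// geometric_cauchy.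
have fhs k : sqint (fun t => f k t - h t).
  apply/sqintP; split; first exact: measurable_funB.
  apply/integrableP; split.
    by apply/measurable_EFinP; apply: measurable_funX; exact: measurable_funB.
  rewrite (le_lt_trans _ (ltry ((2 * 2^-1 ^+ k) ^+ 2)))//.
  apply: le_trans (fatou_bound k); rewrite le_eqVlt; apply/orP; left; apply/eqP.
  by apply: eq_integral => t _; rewrite gee0_abs// lee_fin sqr_ge0.
have hs : sqint h.
  have := sqint_lin (-1) (fhs 0%N) (fs 0%N).
  by congr sqint; apply/funext => t; rewrite mulN1r opprB subrK.
exists (L2of T h) => k.
rewrite -(@ler_pXn2r _ 2)// ?nnegrE ?nrm_ge0 ?mulr_ge0 ?exprn_ge0//.
rewrite (nrm_L2_dotI (fhs k)); last first.
  apply: aeI_trans (L2funB _ _) _.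
  by apply: ae_mono (L2ofE hs) => t ht It; rewrite ht.
rewrite -lee_fin; apply: le_trans (fatou_bound k).
rewrite /dotI/Rintegral fineK; last by apply: integrable_fin_num => //; exact: sqint_mul.
rewrite le_eqVlt; apply/orP; left; apply/eqP.
by apply: eq_integral => t _; rewrite expr2.
Qed.

End Completeness.

(** * Weak derivatives and end values *)

Section Sobolev.
Context (R : realType) (T : R).
Hypothesis T_gt0 : 0 < T.
Local Notation mu := (@lebesgue_measure R).
Local Notation I := [set` `]0, T[].
Local Notation sqint := (sqint T).
Local Notation aeI := (aeI T).
Local Notation dotI := (dotI T).
Local Notation primitiveT := (primitiveT T).
Local Notation volterra0 := (@volterra0 R T).
Local Notation volterraT := (@volterraT R T).

Definition L2one : L2 T := L2of T (fun=> 1).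

Lemma L2one_neq0 : L2one != 0.
Proof.
apply/eqP => one0.
have : ip L2one L2one = 0 by rewrite one0 (dot0l (@ipL R T)).
rewrite ip_L2of; [|exact: sqint_cst..].
rewrite /dotI; under eq_Rintegral do rewrite mulr1.
rewrite Rintegral_cst// mul1r.
have e : fine (mu I) = T by rewrite lebesgue_measure_itv/= lte_fin T_gt0 -EFinD subr0.
by move=> /(etrans (esym e)) T0; move: T_gt0; rewrite T0 ltxx.
Qed.

Lemma primitiveT_end f : sqint f -> primitiveT f T = 0.
Proof. by move=> fs; rewrite /primitiveT -primitive0_T// subrr. Qed.

Lemma cst_sub_volterraT_ae c (w : L2 T) :
  aeI (L2fun (c *: L2one - volterraT w)) (fun t => c - primitiveT (L2fun w) t).
Proof.
apply: aeI_trans (L2funB _ _) _; apply: (aeI_comp2 (fun a b => a - b)); last first.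
  exact/L2ofE/sqint_primitiveT.
apply: aeI_trans (L2funZ _ _) _.
by apply: ae_mono (L2ofE (sqint_cst T 1)) => t h It; rewrite h// mulr1.
Qed.

Lemma sqint_cst_sub c (w : L2 T) : sqint (fun t => c - primitiveT (L2fun w) t).
Proof.
have := sqint_lin (-1) (sqint_primitiveT T_gt0 (sqint_L2 w)) (sqint_cst T c).
by congr sqint; apply/funext => t; rewrite mulN1r addrC.
Qed.

(** That w is the weak derivative of v means that v + V* w is orthogonal to the
derivatives of all test functions, hence constant by du Bois-Reymond. *)
Lemma weak_derivativeP (v w : L2 T) :
  is_weak_derivative v w <-> exists c, v = c *: L2one - volterraT w.
Proof.
have ws := sqint_L2 w; have vs := sqint_L2 v; have Vws := sqint_primitiveT T_gt0 ws.
split=> [vw|[c ->] phi phit].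
  have us : sqint (fun t => L2fun v t + primitiveT (L2fun w) t) by exact: sqintD.
  have [phi phit|c uc] := @test_derive_orthogonal_cst _ _ T_gt0 _ us.
    have [_ s1] := sqint_test phit.
    have := dotI_lin 1 vs Vws s1; rewrite mul1r volterraT_test// -/(dotI _ _) => uE.
    have <- : dotI (L2fun v) (derive1 phi) + dotI (L2fun w) phi = 0.
      have -> : dotI (L2fun v) (derive1 phi) = - dotI (L2fun w) phi := vw _ phit.
      by rewrite addNr.
    by rewrite -uE; congr dotI; apply/funext => t; rewrite mul1r.
  exists c; apply: L2_eq; apply: aeI_trans (aeI_sym (cst_sub_volterraT_ae _ _)).
  by apply: ae_mono uc => t h It; rewrite -(h It) addrK.
have [s0 s1] := sqint_test phit.
change (dotI (L2fun (c *: L2one - volterraT w)) (derive1 phi) = - dotI (L2fun w) phi).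
rewrite (dotI_ae (sqint_L2 _) s1 (sqint_cst_sub c w) s1 (cst_sub_volterraT_ae _ _) (aeI_refl _ _)).
have -> : (fun t => c - primitiveT (L2fun w) t) = (fun t => -1 * primitiveT (L2fun w) t + c).
  by apply/funext => t; rewrite mulN1r addrC.
rewrite dotI_lin//; last exact: sqint_cst.
rewrite volterraT_test// mulN1r.
suff -> : dotI (fun=> c) (derive1 phi) = 0 by rewrite addr0.
rewrite /dotI RintegralZl//; last exact: sqint_integrable.
by rewrite -primitive0_T// primitive0_test// (test_function_out phit (or_intror (lexx T))) mulr0.
Qed.

Lemma weak_derivative_unique (v w w' : L2 T) :
  is_weak_derivative v w -> is_weak_derivative v w' -> w = w'.
Proof.
move=> vw vw'; apply/eqP; rewrite -subr_eq0; apply/eqP/L2_eq.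
apply: aeI_trans (aeI_sym (L2fun0 T)); apply: test_orthogonal_eq0 => // phi phit.
have [s0 _] := sqint_test phit.
have ww' : sqint (fun t => -1 * L2fun w' t + L2fun w t) by exact: sqint_lin.
rewrite (dotI_ae (sqint_L2 _) s0 ww' s0 _ (aeI_refl _ _)); last first.
  apply: aeI_trans (L2funB _ _) _; apply: aeW => t It.
  by rewrite mulN1r addrC.
rewrite dotI_lin// mulN1r; apply/eqP; rewrite addrC subr_eq0; apply/eqP.
by apply: oppr_inj; rewrite -[LHS](vw _ phit) -[RHS](vw' _ phit).
Qed.

Lemma weak_derivativeE (v w : L2 T) : is_weak_derivative v w -> weak_derivative v = w.
Proof.
move=> vw; apply: (@weak_derivative_unique v) => //.
by rewrite /weak_derivative; apply: (@xgetPex _ 0 (is_weak_derivative v)); exists w.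
Qed.

(** If the two functions differed at T, they would differ on a whole interval ]a, T[. *)
Lemma ae_eq_continuous_end (u r : R -> R) :
  {within `[0, T], continuous u} -> {within `[0, T], continuous r} ->
  aeI u r -> u T = r T.
Proof.
move=> cu cr [N [mN N0 sub]]; apply: contrapT => /eqP urT.
have [_ _ uT] := (continuous_within_itvP _ T_gt0).1 cu.
have [_ _ rT] := (continuous_within_itvP _ T_gt0).1 cr.
have cd : (u t - r t) @[t --> T^'-] --> u T - r T by apply: cvgB.
have d0 : 0 < `|u T - r T| by rewrite normr_gt0 subr_eq0.
have nr : \forall t \near T^'-, u t != r t.
  move/cvgrPdist_lt : cd => /(_ _ d0); apply: filterS => t h.
  by apply: contraTneq h => ->; rewrite subrr subr0 ltxx.
have [d /= dpos dP] := nr.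
pose a := Num.max 0 (T - d).
have aT : a < T by rewrite gt_max T_gt0 gtrBl.
have aN : `]a, T[%classic `<=` N.
  move=> t /=; rewrite in_itv/= gt_max => /andP[/andP[t0 td] tT].
  apply: sub => /= ur; have /eqP : u t = r t by apply: ur; rewrite in_itv/= t0.
  apply/negP; apply: dP => //=.
  by rewrite /ball_/= gtr0_norm ?subr_gt0// ltrBlDr -ltrBlDl.
have : (mu `]a, T[%classic <= mu N)%E by apply: le_measure; rewrite ?inE//; exact: measurable_itv.
by rewrite N0 lebesgue_measure_itv/= lte_fin aT -EFinD lee_fin subr_le0 leNgt aT.
Qed.

(** The representative c - V* w is continuous and has value c at T. *)
Lemma end_valueP c (w : L2 T) d : end_value (c *: L2one - volterraT w) d <-> d = c.
Proof.
have cr : {within `[0, T], continuous (fun t => c - primitiveT (L2fun w) t)}.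
  by move=> x; apply: cvgB; [exact: cvg_cst|exact: primitiveT_continuous].
split=> [[u [cu uE <-]]|->].
  have -> : c = c - primitiveT (L2fun w) T by rewrite primitiveT_end// subr0.
  apply: (ae_eq_continuous_end cu cr).
  exact: aeI_trans (aeI_sym uE) (cst_sub_volterraT_ae _ _).
by exists (fun t => c - primitiveT (L2fun w) t); split;
  [exact: cr|exact: cst_sub_volterraT_ae|rewrite primitiveT_end// subr0].
Qed.

End Sobolev.

(** * The operator B and the space Y *)

Section Vector.
Context (R : realType) (T : R).
Hypothesis T_gt0 : 0 < T.
Local Notation volterra0 := (@volterra0 R T).
Local Notation volterraT := (@volterraT R T).
Local Notation L2one := (L2one T).

Section Size.
Variable n : nat.
Local Notation X := (X T n).

Definition dotX (x y : X) : R := \sum_i ip (x i) (y i).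
Local Notation nrmX := (nrm dotX).

Lemma dotXL a u v w : dotX (a *: u + v) w = a * dotX u w + dotX v w.
Proof.
rewrite mulr_sumr -big_split/=; apply: eq_bigr => i _.
by rewrite !ffunE ipL.
Qed.

Lemma dotXC u v : dotX u v = dotX v u.
Proof. by apply: eq_bigr => i _; exact: ipC. Qed.

Lemma dotX_ge0 u : 0 <= dotX u u.
Proof. by apply: sumr_ge0 => i _; exact: ip_ge0. Qed.

Lemma dotX_eq0 u : dotX u u = 0 -> u = 0.
Proof.
move=> /eqP; rewrite psumr_eq0 => [/allP u0|i _]; last exact: ip_ge0.
apply/ffunP => i; rewrite ffunE; apply: ip_eq0; apply/eqP.
by have := u0 i; rewrite mem_index_enum => /(_ erefl).
Qed.

Lemma X_complete (g : nat -> X) : (forall k, nrmX (g k.+1 - g k) <= 2^-1 ^+ k) ->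
  exists x c, forall k, nrmX (g k - x) <= c * 2^-1 ^+ k.
Proof.
move=> gc.
have /choice[xi xiP] i : exists x, forall k, nrm (@ip R T) (g k i - x) <= 2 * 2^-1 ^+ k.
  apply: L2_complete => k; apply: le_trans (gc k); apply: ler_wsqrtr.
  rewrite /dotX (bigD1 i)//= !ffunE lerDl; apply: sumr_ge0 => j _; exact: ip_ge0.
exists [ffun i => xi i], (Num.sqrt n%:R * 2) => k.
rewrite -mulrA -[2 * _]ger0_norm ?mulr_ge0 ?exprn_ge0// -sqrtr_sqr -sqrtrM//.
apply: ler_wsqrtr; rewrite -[n in n%:R]card_ord -sumr_const mulr_suml mul1r.
apply: ler_sum => i _; rewrite !ffunE -(nrm_sqr (@ip_ge0 R T)).
by rewrite lerXn2r ?nnegrE ?nrm_ge0 ?mulr_ge0 ?exprn_ge0.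
Qed.

Lemma dotX_mact (M : 'M[R]_n) (x y : X) : dotX (mact M x) y = dotX x (mact M^T y).
Proof.
transitivity (\sum_i \sum_j M i j * ip (x j) (y i)).
  apply: eq_bigr => i _; rewrite ffunE.
  elim: (index_enum _) => [|j s ih]; first by rewrite !big_nil (dot0l (@ipL R T)).
  by rewrite !big_cons ipL ih.
rewrite exchange_big/=; apply: eq_bigr => j _; rewrite ffunE.
elim: (index_enum _) => [|i s ih]; first by rewrite !big_nil ipC (dot0l (@ipL R T)).
by rewrite !big_cons ih mxE [RHS]ipC ipL (ipC (y i)) (ipC _ (x j)).
Qed.

Lemma dotX_lift (x y : X) : dotX (lift_op volterra0 x) y = dotX x (lift_op volterraT y).
Proof. by apply: eq_bigr => i _; rewrite !ffunE volterra0_adjoint. Qed.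

Definition cstX (c : 'cV[R]_n) : X := [ffun i => c i 0 *: L2one].

Lemma mact_cstX (M : 'M[R]_n) c : mact M (cstX c) = cstX (M *m c).
Proof.
apply/ffunP => i; rewrite !ffunE mxE scaler_suml; apply: eq_bigr => j _.
by rewrite ffunE scalerA.
Qed.

Lemma cstX_linear a c d : cstX (a *: c + d) = a *: cstX c + cstX d.
Proof. by apply/ffunP => i; rewrite !ffunE !mxE scalerDl scalerA. Qed.

Lemma cstX0 : cstX 0 = 0.
Proof. by apply/ffunP => i; rewrite !ffunE mxE scale0r. Qed.

Section Pencil.
Variables (E A : 'M[R]_n) (l : R).
Hypothesis det_neq0 : \det (l *: E - A) != 0.

Lemma Bstar_weakE (y w : X) : (forall j, is_weak_derivative (y j) (w j)) ->
  Bstar E A y = - mact E^T w - mact A^T y.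
Proof.
move=> yw; apply/ffunP => i; rewrite !ffunE; congr (- _ - _).
by apply: eq_bigr => j _; rewrite (weak_derivativeE (yw j)).
Qed.

Lemma Y_param (y : X) : Y E y ->
  exists (c : 'cV[R]_n) (w : X), [/\ E^T *m c = 0, y = cstX c - lift_op volterraT w &
    forall j, is_weak_derivative (y j) (w j)].
Proof.
move=> [yH1 [c yc Ec]].
have /choice[w yw] j : exists w, is_weak_derivative (y j) w by exact: yH1.
exists c, [ffun j => w j]; split => //; last by move=> j; rewrite ffunE.
apply/ffunP => j; rewrite !ffunE.
have [c' yE] := (weak_derivativeP T_gt0 _ _).1 (yw j).
by have := yc j; rewrite yE => /(end_valueP T_gt0) ->.
Qed.

Lemma Y_of_param (c : 'cV[R]_n) (w : X) : E^T *m c = 0 ->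
  Y E (cstX c - lift_op volterraT w) /\
  forall j, is_weak_derivative ((cstX c - lift_op volterraT w) j) (w j).
Proof.
move=> Ec.
have wd j : is_weak_derivative ((cstX c - lift_op volterraT w) j) (w j).
  by apply/(weak_derivativeP T_gt0); exists (c j 0); rewrite !ffunE.
split => //; split; first by move=> j; exists (w j).
by exists c => // j; rewrite !ffunE; apply/(end_valueP T_gt0).
Qed.

(** Additivity of the weak derivative comes from its uniqueness, through the
parametrisation by (c, w). *)
Lemma Y_lin a (u v : X) : Y E u -> Y E v ->
  Y E (a *: u + v) /\ Bstar E A (a *: u + v) = a *: Bstar E A u + Bstar E A v.
Proof.
move=> /Y_param[c [w [Ec uE uw]]] /Y_param[d [z [Ed vE vz]]].
have auvE : a *: u + v = cstX (a *: c + d) - lift_op volterraT (a *: w + z).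
  rewrite cstX_linear (lift_op_linear (volterraT_is_linear T_gt0)) uE vE.
  by rewrite scalerBr opprD addrACA.
have Ecd : E^T *m (a *: c + d) = 0 by rewrite mulmxDr -scalemxAr Ec Ed scaler0 addr0.
have [Yauv wd] := Y_of_param (a *: w + z) Ecd.
split; first by rewrite auvE.
rewrite (Bstar_weakE uw) (Bstar_weakE vz) (@Bstar_weakE _ (a *: w + z)) ?auvE//.
rewrite -auvE !mact_linear scalerBr scalerN !opprD.
by rewrite addrACA.
Qed.

Lemma Y0 : Y E (0 : X).
Proof.
have [+ _] := @Y_of_param 0 0 (mulmx0 _ _).
have -> // : cstX 0 - lift_op volterraT 0 = 0.
rewrite cstX0 sub0r; apply/ffunP => i; rewrite !ffunE.
by rewrite (linear_op0 (volterraT_is_linear T_gt0)) oppr0.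
Qed.

(** With y = c - V* w and E^T c = 0, the equation B y = 0 becomes
E^T y = A^T (V* y), for the transposed pencil, which is again regular. *)
Lemma Bstar_inj (y : X) : Y E y -> Bstar E A y = 0 -> y = 0.
Proof.
move=> /Y_param[c [w [Ec yE yw]]]; rewrite (Bstar_weakE yw) => /eqP.
rewrite subr_eq0 => /eqP EwAy.
apply: (volterraT_pencil_unique T_gt0 (E := E^T) (A := A^T) (l := l)).
  by rewrite -linearZ -linearB det_tr.
rewrite -(mact_lift (volterraT_is_linear T_gt0)) -EwAy.
rewrite -mactN (mact_lift (volterraT_is_linear T_gt0)) {1}yE mactD mact_cstX Ec cstX0 add0r.
by congr mact; apply/ffunP => i; rewrite !ffunE (linear_opN (volterraT_is_linear T_gt0)).
Qed.

(** Testing against y = - V* w, with w = E x - A V x, shows that w is orthogonal to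
itself. *)
Lemma Bstar_dense_orth (x : X) : (forall y, Y E y -> dotX x (Bstar E A y) = 0) -> x = 0.
Proof.
move=> xB; apply: (volterra0_pencil_unique T_gt0 det_neq0).
apply/eqP; rewrite -subr_eq0; apply/eqP/dotX_eq0.
set w := mact E x - mact A (lift_op volterra0 x).
have [Yy yw] := @Y_of_param 0 w (mulmx0 _ _).
have := xB _ Yy; rewrite (Bstar_weakE yw) cstX0 sub0r mactN opprK addrC.
rewrite (dotBr dotXL dotXC) => h.
rewrite {1}/w (dotBl dotXL) !dotX_mact dotX_lift (mact_lift (volterraT_is_linear T_gt0)).
by rewrite -opprB h oppr0.
Qed.

End Pencil.
End Size.
End Vector.

(** * Well-posedness and the inf-sup constants *)

Section WellPosed.
Context (R : realType) (T : R) (n : nat).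
Hypothesis T_gt0 : 0 < T.
Variables (E A : 'M[R]_n) (l : R).
Hypothesis det_neq0 : \det (l *: E - A) != 0.
Local Notation volterra0 := (@volterra0 R T).
Local Notation volterraT := (@volterraT R T).
Local Notation X := (X T n).
Local Notation nrmX := (nrm (@dotX R T n)).
Local Notation B := (Bstar E A : X -> X).
Local Notation dotX_cs := (dot_le_nrm (@dotXL R T n) (@dotXC R T n) (@dotX_ge0 R T n)).

Lemma Bstar_riesz (f : X -> R) (C : R) :
  (forall a u v, Y E u -> Y E v -> f (a *: u + v) = a * f u + f v) ->
  (forall y, Y E y -> `|f y| <= C * nrmX (B y)) ->
  exists x, (forall y, Y E y -> dotX x (B y) = f y) /\
    (forall e, 0 < e -> exists2 y, Y E y & nrmX (B y - x) <= e).
Proof.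
move=> flin fC.
apply: (@riesz_range R X (@dotX R T n) (@dotXL _ _ _) (@dotXC _ _ _) (@dotX_ge0 _ _ _)
  (@X_complete R T n) X (Y E) B f C).
- exact: Y0.
- by move=> a u v Yu Yv; exact: (Y_lin T_gt0 A a Yu Yv).1.
- by move=> a u v Yu Yv; exact: (Y_lin T_gt0 A a Yu Yv).2.
- exact: flin.
- exact: fC.
Qed.

Lemma dotX_Bstar_unique (x x' : X) :
  (forall y, Y E y -> dotX x (B y) = dotX x' (B y)) -> x = x'.
Proof.
move=> xx'; apply/eqP; rewrite -subr_eq0; apply/eqP.
apply: (Bstar_dense_orth T_gt0 det_neq0) => y Yy.
by rewrite (dotBl (@dotXL R T n)) xx'// subrr.
Qed.

(** The minimising sequence for the functional <x, B y> converges to a vector that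
represents it, and this vector is x by uniqueness. *)
Lemma Bstar_dense (x : X) (e : R) : 0 < e -> exists2 y, Y E y & nrmX (B y - x) <= e.
Proof.
have [||x' [x'E dense]] := @Bstar_riesz (fun y => dotX x (B y)) (nrmX x).
- move=> a u v Yu Yv; rewrite (Y_lin T_gt0 A a Yu Yv).2.
  by rewrite (dotDr (@dotXL R T n) (@dotXC R T n)) (dotZr (@dotXL R T n) (@dotXC R T n)).
- by move=> y _; exact: dotX_cs.
by rewrite -(dotX_Bstar_unique x'E); exact: dense.
Qed.

(** As x(0) = 0, x = V x'.  Hence <x, - E^T w> = <x', - E^T V* w> = <x', E^T y>,
because E^T c = 0: integration by parts without boundary terms. *)
Lemma classical_solution_weak (ft xt : 'I_n -> R -> R) :
  classical_solution T E A ft xt ->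
  let x : X := [ffun i => L2of T (xt i)] in
  (forall i, aeI T (L2fun (x i)) (xt i)) /\
  forall y : X, Y E y -> dotX x (B y) = dotL2 T ft (Xfun y).
Proof.
move=> [xC1 xode x0] x.
have xs i : sqint T (xt i) by apply: sqint_continuous; exact: (xC1 i).1.
split=> [i|y /(Y_param T_gt0)[c [w [Ec yE yw]]]].
  by rewrite ffunE; exact: L2ofE.
have /choice[dx dxP] i : exists dx : R -> R, {within `[0, T], continuous dx} /\
    forall t, t \in `]0, T[ -> is_derive t 1 (xt i) (dx t).
  by have [_ [dx dxc dxd]] := xC1 i; exists dx.
have dxs i : sqint T (dx i) by apply: sqint_continuous; exact: (dxP i).1.
pose p : X := [ffun i => L2of T (dx i)].
have xE : x = lift_op volterra0 p.
  apply/ffunP => i; rewrite !ffunE; apply/esym/L2of_eq => //.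
  apply: aeI_trans (L2ofE (sqint_primitive0 T_gt0 (sqint_L2 _))) _.
  apply: aeW => t; rewrite /= in_itv/= => /andP[t0 tT].
  rewrite (primitive0_ae _ (sqint_L2 _) (dxs i) (L2ofE (dxs i))).
  have -> := @primitive0_FTC R T (xt i) (dx i) t (xC1 i).1 (dxP i).1 (dxP i).2 t0 (ltW tT).
  by rewrite x0 subr0.
transitivity (dotX (mact E p - mact A x) y).
  rewrite (Bstar_weakE E A yw) (dotBr (@dotXL R T n) (@dotXC R T n)).
  rewrite (dotBl (@dotXL R T n)) !dotX_mact; congr (_ - _).
  rewrite {1}xE (dotX_lift T_gt0) -mactN (mact_lift (volterraT_is_linear T_gt0)).
  congr (dotX p).
  rewrite yE mactD mact_cstX Ec cstX0 add0r; congr (mact _ _).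
  by apply/ffunP => i; rewrite !ffunE (linear_opN (volterraT_is_linear T_gt0)).
apply: eq_bigr => i _.
pose r t := \sum_j E i j * dx j t + -1 * \sum_j A i j * xt j t.
have sE : sqint T (fun t => \sum_j E i j * dx j t).
  by apply: sqint_sum => j; exact: sqintZ.
have sA : sqint T (fun t => \sum_j A i j * xt j t).
  by apply: sqint_sum => j; exact: sqintZ.
have rs : sqint T r by apply: sqintD => //; exact: sqintZ.
transitivity (dotI T r (L2fun (y i))).
  apply: dotI_ae => //.
  have -> : (mact E p - mact A x) i = mact E p i - mact A x i by rewrite !ffunE.
  apply: aeI_trans (L2funB _ _) _.
  have eqE : aeI T (L2fun (mact E p i)) (fun t => \sum_j E i j * dx j t).
    rewrite ffunE; apply: aeI_trans (L2fun_sum _ _ _) _; apply: aeI_sum => j.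
    by rewrite ffunE; apply: ae_mono (L2ofE (dxs j)) => t h It; rewrite h.
  have eqA : aeI T (L2fun (mact A x i)) (fun t => \sum_j A i j * xt j t).
    rewrite ffunE; apply: aeI_trans (L2fun_sum _ _ _) _; apply: aeI_sum => j.
    by rewrite ffunE; apply: ae_mono (L2ofE (xs j)) => t h It; rewrite h.
  by apply: ae_mono2 eqE eqA => t h1 h2 It; rewrite h1// h2// /r mulN1r.
apply: eq_Rintegral => t; rewrite inE => It; congr (_ * _).
have /matrixP/(_ i 0) := xode t It.
rewrite !mxE => <-; rewrite /r mulN1r; congr (_ - _).
  apply: eq_bigr => j _; rewrite mxE; congr (_ * _).
  by rewrite derive1E; have [_ ->] := (dxP j).2 t It.
by apply: eq_bigr => j _; rewrite mxE.
Qed.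

Lemma Bstar0 : B 0 = 0.
Proof.
have := (Y_lin T_gt0 A (-1) (Y0 T_gt0 E) (Y0 T_gt0 E)).2.
by rewrite scaler0 addr0 scaleN1r addNr.
Qed.

Lemma nrmX_gt0 (x : X) : x != 0 -> 0 < nrmX x.
Proof.
move=> x0; rewrite lt_neqAle nrm_ge0 andbT eq_sym; apply: contra x0 => /eqP nx0.
by apply/eqP/dotX_eq0; rewrite -(nrm_sqr (@dotX_ge0 R T n)) nx0 expr0n.
Qed.

Lemma bquot_le1 (x y : X) : (bquot E A x y <= 1)%E.
Proof.
rewrite lee_fin; change (dotX x (B y) / (nrmX x * nrmX (B y)) <= 1).
have := mulr_ge0 (nrm_ge0 (@dotX R T n) x) (nrm_ge0 (@dotX R T n) (B y)).
rewrite le_eqVlt => /predU1P[<-|h]; first by rewrite invr0 mulr0.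
by rewrite ler_pdivrMr// mul1r (le_trans (ler_norm _))// dotX_cs.
Qed.

Lemma Bstar_neq0 (y : X) : Y E y -> y != 0 -> B y != 0.
Proof. by move=> Yy; apply: contraNneq => /(Bstar_inj T_gt0 det_neq0 Yy) ->. Qed.

(** If B y is at distance at most d |x| from x, the quotient is at least
(1 - d) / (1 + d) >= 1 - 2 d. *)
Lemma sup_over_Y (x : X) : x != 0 ->
  ereal_sup [set bquot E A x y | y in nonzeroY E] = 1%E.
Proof.
move=> x0; have nx := nrmX_gt0 x0.
apply/eqP; rewrite eq_le; apply/andP; split.
  by apply: ge_ereal_sup => _ [y _ <-]; exact: bquot_le1.
apply/lee_subgt0Pr => e e0.
(* d <= 1/2 keeps <x, B y> positive, so that y is nonzero *)
pose d := Num.min 2^-1 (e / 2).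
have d0 : 0 < d by rewrite lt_min invr_gt0 ltr0n divr_gt0.
have d1 : d <= 2^-1 by rewrite ge_min lexx.
have d2 : d <= e / 2 by rewrite ge_min lexx orbT.
have [y Yy yx] := @Bstar_dense x (d * nrmX x) (mulr_gt0 d0 nx).
have By_ge : nrmX (B y) <= (1 + d) * nrmX x.
  have := nrm_triangle (@dotXL R T n) (@dotXC R T n) (@dotX_ge0 R T n) (B y - x) x.
  rewrite subrK; lra.
have xBy : (1 - d) * nrmX x ^+ 2 <= dotX x (B y).
  have : `|dotX x (B y - x)| <= nrmX x * (d * nrmX x).
    by apply: (le_trans (dotX_cs _ _)); rewrite ler_wpM2l// nrm_ge0.
  rewrite (dotBr (@dotXL R T n) (@dotXC R T n)) -(nrm_sqr (@dotX_ge0 R T n)).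
  by move=> /ler_normlP[]; lra.
have xBy0 : 0 < dotX x (B y).
  apply: lt_le_trans xBy; rewrite mulr_gt0// ?exprn_gt0// subr_gt0.
  by apply: (le_lt_trans d1); rewrite invf_lt1 ?ltr1n.
have By0 : B y != 0.
  by apply: contraTneq xBy0 => ->; rewrite dotXC (dot0l (@dotXL R T n)) ltxx.
have nBy := nrmX_gt0 By0.
have y0 : y != 0.
  by apply: contraNneq By0 => ->; rewrite Bstar0.
apply: (@le_trans _ _ (bquot E A x y)); last first.
  by apply: ereal_sup_ubound; exists y.
rewrite -EFinB lee_fin; change (1 - e <= dotX x (B y) / (nrmX x * nrmX (B y))).
rewrite ler_pdivlMr ?mulr_gt0//; apply: le_trans xBy.
(* for e > 1 the left-hand side is negative *)
have [e1|e1] := leP e 1; last first.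
  apply: (@le_trans _ _ 0).
    by apply: mulr_le0_ge0; [rewrite subr_le0 ltW|exact/ltW/mulr_gt0].
  by rewrite mulr_ge0 ?sqr_ge0// subr_ge0 (le_trans d1)// invf_le1// ler1n.
apply: (@le_trans _ _ ((1 - e) * (nrmX x * ((1 + d) * nrmX x)))).
  by rewrite ler_wpM2l ?subr_ge0// ler_wpM2l// ltW.
rewrite (_ : _ * _ = ((1 - e) * (1 + d)) * nrmX x ^+ 2); last by ring.
by rewrite ler_wpM2r ?sqr_ge0//; have := mulr_gt0 e0 d0; lra.
Qed.

(** Equality holds in the Cauchy-Schwarz inequality at x = B y. *)
Lemma sup_over_X (y : X) : Y E y -> y != 0 ->
  ereal_sup [set bquot E A x y | x in @nonzeroX R T n] = 1%E.
Proof.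
move=> Yy y0; have By0 := Bstar_neq0 Yy y0.
apply/eqP; rewrite eq_le; apply/andP; split.
  by apply: ge_ereal_sup => _ [x _ <-]; exact: bquot_le1.
apply: ereal_sup_ubound; exists (B y) => //.
congr EFin; change (dotX (B y) (B y) / (nrmX (B y) * nrmX (B y)) = 1).
by rewrite -expr2 (nrm_sqr (@dotX_ge0 R T n)) divff// -(nrm_sqr (@dotX_ge0 R T n))
  gt_eqF// exprn_gt0// nrmX_gt0.
Qed.

Lemma nonzeroY_exists : (0 < n)%N -> exists y : X, Y E y /\ y != 0.
Proof.
move=> n0; pose w : X := [ffun=> L2one T].
have [Yy _] := @Y_of_param R T T_gt0 n E 0 w (mulmx0 _ _).
exists (cstX T 0 - lift_op volterraT w); split => //.
rewrite cstX0 sub0r oppr_eq0; apply: contraNneq (L2one_neq0 T_gt0) => w0.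
have /ffunP/(_ (Ordinal n0)) := lift_op_inj (volterraT_inj T_gt0) w0.
by rewrite !ffunE => ->.
Qed.

End WellPosed.

Theorem lemma2p5 (R : realType) (n p : nat) (T : R)
    (P : set 'rV[R]_p) (E : 'M[R]_n) (A : 'rV[R]_p -> 'M[R]_n)
    (n_gt0 : (0 < n)%N) (T_gt0 : 0 < T) (P_compact : compact P)
    (regular : forall mu, P mu -> regular_pencil E (A mu))
    (mu : 'rV[R]_p) (Pmu : P mu) :
  (forall f : X T n -> R, dualY E (A mu) f ->
     exists x : X T n,
       [/\ forall y, Y E y -> bform E (A mu) x y = f y,
           forall x' : X T n,
             (forall y, Y E y -> bform E (A mu) x' y = f y) -> x' = x
         & forall ft xt : 'I_n -> R -> R,
             (forall i, {within `]0, T[, continuous (ft i)}) ->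
             classical_solution T E (A mu) ft xt ->
             (forall y, Y E y -> f y = dotL2 T ft (Xfun y)) ->
             forall i, Xfun x i = xt i %[ae lebesgue_measure in `]0, T[%classic]]) /\
  [/\ gamma T E (A mu) = 1%E, beta T E (A mu) = 1%E & beta_star T E (A mu) = 1%E].
Proof.
have [l det_neq0] := regular mu Pmu.
split=> [f [f_lin [C f_bound]]|].
  have [x [xf _]] := Bstar_riesz T_gt0 f_lin f_bound.
  have unique (x' : X T n) : (forall y, Y E y -> bform E (A mu) x' y = f y) -> x' = x.
    move=> x'f; apply: (dotX_Bstar_unique T_gt0 det_neq0) => y Yy.
    by rewrite xf// -x'f.
  exists x; split => // ft xt _ xt_sol f_ft i.
  have [xL2_ae xL2_weak] := classical_solution_weak T_gt0 xt_sol.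
  rewrite -(unique [ffun i => L2of T (xt i)]); first exact: xL2_ae.
  by move=> y Yy; rewrite f_ft//; exact: xL2_weak.
have [y [Yy y_neq0]] := nonzeroY_exists T_gt0 E n_gt0.
have sup_xy : [set ereal_sup [set bquot E (A mu) x y | y in nonzeroY E]
    | x in @nonzeroX R T n] = [set 1%E].
  apply/seteqP; split => [_ [x x_neq0 <-]|_ ->]; first exact: (sup_over_Y T_gt0 det_neq0).
  by exists y => //; exact: (sup_over_Y T_gt0 det_neq0).
have sup_yx : [set ereal_sup [set bquot E (A mu) x y | x in @nonzeroX R T n]
    | y in nonzeroY E] = [set 1%E].
  apply/seteqP; split => [_ [z [Yz z_neq0] <-]|_ ->]; first exact: (sup_over_X T_gt0 det_neq0).
  by exists y => //; exact: (sup_over_X T_gt0 det_neq0).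
by split; rewrite ?/gamma ?/beta ?/beta_star ?sup_xy ?sup_yx ?ereal_sup1 ?ereal_inf1.
Qed.
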